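(* Let $S^{(1)},S^{(2)}\in\operatorname{Sp}(2n,\mathbb{R})$ and let $\widehat{S^{(1)}},\widehat{S^{(2)}}$ be metaplectic operators projecting onto them. Let $f\in L^2(\mathbb{R}^n)$, $f\neq 0$, be such that $|x|\,\widehat{S^{(1)}}f\in L^2(\mathbb{R}^n)$ and $|\xi|\,\widehat{S^{(2)}}f\in L^2(\mathbb{R}^n)$. Then $$\Delta_{S^{(1)}}x\;\Delta_{S^{(2)}}\xi\;\ge\;\frac{\|f\|_2^2}{4\pi}\sum_{j=1}^n\left|\left(S^{(1)}J(S^{(2)})^T\right)_{jj}\right| .$$
   Context: $J=\begin{pmatrix}0&I_n\\-I_n&0\end{pmatrix}$, and $\operatorname{Sp}(2n,\mathbb{R})$ is the group of real $2n\times 2n$ matrices $S$ with $S^TJS=J$. Write $S=\begin{pmatrix}A&B\\C&D\end{pmatrix}$ with $n\times n$ blocks; $S$ is called free if $\det B\ne 0$. Metaplectic operators: to each $S\in\operatorname{Sp}(2n,\mathbb{R})$ correspond two unitary operators $\pm\widehat S$ on $L^2(\mathbb{R}^n)$ (they ''project onto $S$''). For $S$ free, $$(\widehat S f)(\xi)=\frac{c}{\sqrt{|\det B|}}\int_{\mathbb{R}^n}f(x)\,e^{i\pi(\xi\cdot DB^{-1}\xi+x\cdot B^{-1}Ax)-2\pi i\,x\cdot B^{-1}\xi}\,dx,\qquad f\in\mathcal{S}(\mathbb{R}^n),$$ with $c$ a constant of modulus $1$ (fixed up to sign), extended to $L^2$ by unitarity. Every $S\in\operatorname{Sp}(2n,\mathbb{R})$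 is a product $S=S_1S_2$ of two free symplectic matrices, and $\widehat S=\pm\widehat{S_1}\widehat{S_2}$. Only $|\widehat S f|$ matters here. Spread: for $S\in\operatorname{Sp}(2n,\mathbb{R})$ and $f\ne0$ with $\widehat Sf,\ |\xi|\widehat Sf\in L^2(\mathbb{R}^n)$, $\Delta_S\xi\ge0$ is defined by $$(\Delta_S\xi)^2=\int_{\mathbb{R}^n}|\xi-\langle\xi\rangle|^2\,|(\widehat Sf)(\xi)|^2\,d\xi,\qquad \langle\xi\rangle=(\langle\xi_1\rangle,\dots,\langle\xi_n\rangle),\quad \langle\xi_j\rangle=\int_{\mathbb{R}^n}\xi_j\frac{|(\widehat Sf)(\xi)|^2}{\|f\|_2^2}\,d\xi .$$ $\Delta_{S^{(1)}}x$ is the same quantity for $S=S^{(1)}$ with the variable named $x$. *)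

(* Defs.v *)
From HB Require Import structures.
From mathcomp Require Import all_boot all_order all_algebra.
From mathcomp Require Import all_classical all_reals all_analysis.
From mathcomp Require Import complex.

Set Implicit Arguments.
Unset Strict Implicit.
Unset Printing Implicit Defensive.

Import Order.TTheory GRing.Theory Num.Theory.
Import numFieldNormedType.Exports.
Import ComplexField.Normc.

Local Open Scope classical_set_scope.
Local Open Scope ring_scope.

(* Matrices carry the sigma-algebra generated by the coordinates, i.e. the
   Borel sigma-algebra. *)
Section measurable_matrix.
Context {R : realType} (m n : nat).

Definition mx_measurable : set (set 'M[R]_(m, n)) :=
  <<s \bigcup_(ij in [set: 'I_m * 'I_n])
        preimage_set_system setT (fun A : 'M[R]_(m, n) => A ij.1 ij.2)
          measurable >>.

Let mx_measurable0 : mx_measurable set0.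
Proof. exact: sigma_algebra0. Qed.

Let mx_measurableC A : mx_measurable A -> mx_measurable (~` A).
Proof. exact: sigma_algebraC. Qed.

Let mx_measurable_bigcup (F : (set 'M[R]_(m, n))^nat) :
  (forall i, mx_measurable (F i)) -> mx_measurable (\bigcup_i F i).
Proof. exact: sigma_algebra_bigcup. Qed.

HB.instance Definition _ := @isMeasurable.Build default_measure_display
  'M[R]_(m, n) mx_measurable mx_measurable0 mx_measurableC mx_measurable_bigcup.

Lemma measurable_mx_coord i j :
  measurable_fun setT (fun A : 'M[R]_(m, n) => A i j).
Proof.
move=> _ Y mY; rewrite setTI; apply: sub_sigma_algebra.
by exists (i, j) => //; exists Y => //; rewrite setTI.
Qed.

Lemma measurable_fun_mxP d (T : measurableType d) (f : T -> 'M[R]_(m, n)) :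
  (forall i j, measurable_fun setT (fun x => f x i j)) -> measurable_fun setT f.
Proof.
move=> mf; apply: (@measurability _ _ _ _ _ _
  (\bigcup_(ij in [set: 'I_m * 'I_n])
     preimage_set_system setT (fun A : 'M[R]_(m, n) => A ij.1 ij.2) measurable)).
  by [].
move=> _ [_ [ij _ [Y mY <-]] <-]; rewrite setTI.
by have := mf ij.1 ij.2 measurableT Y mY; rewrite !setTI.
Qed.

End measurable_matrix.

(* Lebesgue measure on R^n, by recursion on n: the image of the product of the
   Lebesgue measures on R and on R^n under (t, v) |-> (t, v_1, ..., v_n). *)
Section lebesgue_measure_cV.
Context {R : realType}.

Definition cV_cons n (p : measurableTypeR R * 'cV[R]_n) : 'cV[R]_n.+1 :=
  col_mx (p.1 : R)%:M p.2.

Definition cV_uncons n (v : 'cV[R]_n.+1) : measurableTypeR R * 'cV[R]_n :=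
  (v ord0 ord0, @dsubmx R 1 n 1 v).

Lemma cV_cons0 n p : @cV_cons n p ord0 ord0 = p.1.
Proof.
rewrite /cV_cons (_ : ord0 = @lshift 1 n 0); last exact/val_inj.
by rewrite [LHS]col_mxEu mxE eqxx mulr1n.
Qed.

Lemma cV_consS n p (i : 'I_n) j : @cV_cons n p (@rshift 1 n i) j = p.2 i j.
Proof. by rewrite [LHS]col_mxEd. Qed.

Lemma measurable_cV_cons n : measurable_fun setT (@cV_cons n).
Proof.
apply: measurable_fun_mxP => i j; rewrite ord1.
case: (@splitP 1 n i) => k ik.
- have -> : i = ord0 by apply/val_inj; rewrite /= ik ord1.
  under eq_fun do rewrite cV_cons0.
  exact: measurable_fst.
- have -> : i = rshift 1 k by exact/val_inj.
  under eq_fun do rewrite cV_consS.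
  exact: (measurableT_comp (@measurable_mx_coord R n 1 k 0)).
Qed.

Lemma measurable_cV_uncons n : measurable_fun setT (@cV_uncons n).
Proof.
apply/measurable_fun_pairP; split.
  exact: (@measurable_mx_coord R n.+1 1 ord0 ord0).
apply: measurable_fun_mxP => i j.
have -> : (fun v : 'cV[R]_n.+1 => (snd \o @cV_uncons n) v i j) =
          (fun v : 'cV[R]_n.+1 => v (@rshift 1 n i) j).
  by apply/funext => v; rewrite /= mxE.
exact: measurable_mx_coord.
Qed.

Lemma cV_consK n : cancel (@cV_cons n) (@cV_uncons n).
Proof.
move=> [t v]; rewrite /cV_uncons cV_cons0 /=; congr pair.
by rewrite /cV_cons col_mxKd.
Qed.

Section step.
Variables (n : nat) (mu : {sigma_finite_measure set 'cV[R]_n -> \bar R}).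

Definition cV_measureS : set 'cV[R]_n.+1 -> \bar R :=
  pushforward ((@lebesgue_measure R) \x mu)%E (@cV_cons n).

Let cV_measureS0 : cV_measureS set0 = 0%E.
Proof. by rewrite /cV_measureS /pushforward preimage_set0 measure0. Qed.

Let cV_measureS_ge0 A : (0 <= cV_measureS A)%E.
Proof. by rewrite /cV_measureS /pushforward; exact: measure_ge0. Qed.

Let cV_measureS_sigma_additive : semi_sigma_additive cV_measureS.
Proof.
move=> F mF tF mUF; rewrite /cV_measureS /pushforward preimage_bigcup.
apply: measure_semi_sigma_additive.
- by move=> i; rewrite -[X in measurable X]setTI; exact: measurable_cV_cons.
- apply/trivIsetP => i j _ _ ij; rewrite -preimage_setI.
  by move/trivIsetP : tF => /(_ _ _ _ _ ij) -> //; rewrite preimage_set0.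
- rewrite -preimage_bigcup -[X in measurable X]setTI.
  exact: measurable_cV_cons.
Qed.

HB.instance Definition _ := isMeasure.Build _ _ _ cV_measureS
  cV_measureS0 cV_measureS_ge0 cV_measureS_sigma_additive.

Let cV_measureS_sigma_finite : sigma_finite setT cV_measureS.
Proof.
have /sigma_finiteP[F [TF ndF Foo]] := sigma_finiteT (@lebesgue_measure R).
have /sigma_finiteP[G [TG ndG Goo]] := sigma_finiteT mu.
exists (fun i => @cV_uncons n @^-1` (F i `*` G i)).
  apply/esym/seteqP; split=> // v _.
  have [j _ Fj] : (\bigcup_i F i) (@cV_uncons n v).1 by rewrite -TF.
  have [k _ Gk] : (\bigcup_i G i) (@cV_uncons n v).2 by rewrite -TG.
  exists (maxn j k) => //; split.
    exact: (subsetPset _ _ (ndF _ _ (leq_maxl j k))).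
  exact: (subsetPset _ _ (ndG _ _ (leq_maxr j k))).
move=> i; have [mF Fi] := Foo i; have [mG Gi] := Goo i.
have mFG : measurable (F i `*` G i) by exact: measurableX.
split; first by rewrite -[X in measurable X]setTI; exact: measurable_cV_uncons.
rewrite /cV_measureS /pushforward -comp_preimage.
rewrite (_ : _ \o _ = id) ?preimage_id; last first.
  by apply/funext => p; exact: cV_consK.
by rewrite product_measure1E// lte_mul_pinfty// ge0_fin_numE.
Qed.

HB.instance Definition _ := Measure_isSigmaFinite.Build _ _ _ cV_measureS
  cV_measureS_sigma_finite.

End step.

Fixpoint lebesgue_cV n : {sigma_finite_measure set 'cV[R]_n -> \bar R} :=
  if n is n'.+1 then cV_measureS (lebesgue_cV n') else \d_(0 : 'cV[R]_0).

End lebesgue_measure_cV.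

Lemma lebesgue_cV_box {R : realType} n (A : 'I_n -> set R) :
  (forall i, measurable (A i)) ->
  lebesgue_cV n [set v : 'cV[R]_n | forall i, A i (v i 0)] =
  (\prod_(i < n) (@lebesgue_measure R) (A i))%E.
Proof.
elim: n A => [|n IH] A mA.
  rewrite big_ord0 /= diracE mem_set//; by case.
have mAS : measurable [set v : 'cV[R]_n | forall i, A (lift ord0 i) (v i 0)].
  rewrite (_ : mkset _ = \bigcap_(i in [set: 'I_n])
     ((fun v : 'cV[R]_n => v i 0) @^-1` A (lift ord0 i))); last first.
    by apply/seteqP; split => [v /= Av i _|v /= Av i]; exact: Av.
  apply: fin_bigcap_measurable => // i _; rewrite -[X in measurable X]setTI.
  exact: measurable_mx_coord.
rewrite big_ord_recl -(IH (fun i => A (lift ord0 i))); last by move=> i; exact: mA.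
rewrite -product_measure1E//; last exact: mA.
rewrite /= /cV_measureS /pushforward; congr (_ _).
have lrE (i : 'I_n) : lift ord0 i = rshift 1 i by exact/val_inj.
apply/seteqP; split => [p /= Ap|p /= [A0 AS] i].
  split; first by have := Ap ord0; rewrite cV_cons0.
  by move=> i; have := Ap (lift ord0 i); rewrite {2}lrE cV_consS.
have [j ->|->] := unliftP ord0 i; last by rewrite cV_cons0.
by rewrite {2}lrE cV_consS; exact: AS.
Qed.

Local Open Scope complex_scope.

Section euclidean_space.
Context {R : realType} {n : nat}.
Implicit Types (x y : 'cV[R]_n) (f g : 'cV[R]_n -> R[i]).

Local Notation lambda := (@lebesgue_cV R n).

Definition dotp x y : R := \sum_(i < n) x i 0 * y i 0.

(* Mathcomp-analysis's norm on matrices is the sup norm. *)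
Definition enorm x : R := Num.sqrt (dotp x x).

Definition expi (t : R) : R[i] := cos t +i* sin t.

Definition Cintegral f : R[i] :=
  (\int[lambda]_x complex.Re (f x)) +i* (\int[lambda]_x complex.Im (f x)).

(* L^2 is handled through its representatives, up to lambda-a.e. equality. *)
Definition aeeq f g := {ae lambda, forall x, f x = g x}.

Definition L2 f :=
  [/\ measurable_fun setT (fun x => complex.Re (f x)),
      measurable_fun setT (fun x => complex.Im (f x)) &
      (\int[lambda]_x (normc (f x) ^+ 2)%:E < +oo)%E].

Definition L2normsq f : R := \int[lambda]_x normc (f x) ^+ 2.

Definition partials (s : seq 'I_n) (u : 'cV[R]_n -> R) : 'cV[R]_n -> R :=
  foldr (fun j h => fun x => 'D_(delta_mx j 0) h x) u s.

Definition smooth (u : 'cV[R]_n -> R) :=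
  forall s : seq 'I_n, continuous (partials s u) /\
    forall j x, derivable (partials s u) x (delta_mx j 0).

Definition rapidly_decreasing (u : 'cV[R]_n -> R) :=
  forall (s : seq 'I_n) (k : nat),
    exists M : R, forall x, enorm x ^+ k * `|partials s u x| <= M.

Definition schwartz f :=
  [/\ smooth (fun x => complex.Re (f x)), smooth (fun x => complex.Im (f x)),
      rapidly_decreasing (fun x => complex.Re (f x)) &
      rapidly_decreasing (fun x => complex.Im (f x))].

Record unitary_op (T : ('cV[R]_n -> R[i]) -> ('cV[R]_n -> R[i])) : Prop := {
  unitary_L2 : forall f, L2 f -> L2 (T f);
  unitary_aeeq : forall f g, L2 f -> L2 g -> aeeq f g -> aeeq (T f) (T g);
  unitary_linear : forall (a : R[i]) f g, L2 f -> L2 g ->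
    aeeq (T (fun x => a * f x + g x)) (fun x => a * T f x + T g x);
  unitary_isometry : forall f, L2 f -> L2normsq (T f) = L2normsq f;
  unitary_surj : forall g, L2 g -> exists2 f, L2 f & aeeq (T f) g }.

End euclidean_space.

Section symplectic.
Context {R : realType} {n : nat}.
Implicit Types S : 'M[R]_(n + n).

Definition Jmx : 'M[R]_(n + n) := block_mx 0 1%:M (- 1%:M) 0.

Definition symplectic S := S^T *m Jmx *m S = Jmx.

Definition is_free S := \det (ursubmx S) != 0.

(* The integrand's oscillating factor, for S = (A, B; C, D) with B invertible. *)
Definition free_kernel S (xi x : 'cV[R]_n) : R[i] :=
  let A := ulsubmx S in let B := ursubmx S in let D := drsubmx S in
  expi (pi * (dotp xi (D *m invmx B *m xi) + dotp x (invmx B *m A *m x))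
        - 2 * pi * dotp x (invmx B *m xi)).

(* The constant c is any number of modulus 1: operators differing by a phase are
   not distinguished, so that the sign in S^ = +-S1^ S2^ is absorbed by c. *)
Definition free_metaplectic S (T : ('cV[R]_n -> R[i]) -> ('cV[R]_n -> R[i])) :=
  [/\ symplectic S, is_free S, unitary_op T &
    exists2 c : R[i], normc c = 1 &
      forall f, schwartz f -> aeeq (T f) (fun xi =>
        c * ((Num.sqrt `|\det (ursubmx S)|)^-1)%:C *
        Cintegral (fun x => f x * free_kernel S xi x))].

Definition metaplectic S (T : ('cV[R]_n -> R[i]) -> ('cV[R]_n -> R[i])) :=
  free_metaplectic S T \/
  exists S1 S2 T1 T2,
    [/\ free_metaplectic S1 T1, free_metaplectic S2 T2, S = S1 *m S2,
        unitary_op T & forall f, L2 f -> aeeq (T f) (T1 (T2 f))].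

Definition mean (T : ('cV[R]_n -> R[i]) -> ('cV[R]_n -> R[i])) f : 'cV[R]_n :=
  \col_(j < n) \int[lebesgue_cV n]_xi
    (xi j 0 * (normc (T f xi) ^+ 2 / L2normsq f)).

Definition spread (T : ('cV[R]_n -> R[i]) -> ('cV[R]_n -> R[i])) f : R :=
  Num.sqrt (\int[lebesgue_cV n]_xi
              (enorm (xi - mean T f) ^+ 2 * normc (T f xi) ^+ 2)).

End symplectic.

(* Main.v *)
Require Import Defs.
From HB Require Import structures.
From mathcomp Require Import all_boot all_order all_algebra.
From mathcomp Require Import finmap.
From mathcomp Require Import all_classical all_reals all_analysis.
From mathcomp Require Import measurable_realfun complex.
From mathcomp Require Import ring lra.

Set Implicit Arguments.
Unset Strict Implicit.
Unset Printing Implicit Defensive.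

Import Order.TTheory GRing.Theory Num.Theory.
Import numFieldNormedType.Exports.
Import ComplexField.Normc.

Local Open Scope classical_set_scope.
Local Open Scope ring_scope.
Local Open Scope complex_scope.

(** Heisenberg's argument, carried out with unitary groups instead of unbounded
operators.  Write W(a, b) f (x) = exp(2 pi i b.x) f(x - a) for the phase space
translations.  A metaplectic operator T over S intertwines them up to phases:
T W(z) = w W(S z) T with |w| = 1 (metaplectic_covariant).  For
z = S^-1 (0, d e_j) the operator W(S z) is modulation by exp(2 pi i d x_j), so
the unitary group generated by the observable T^-1 x_j T consists of explicit
operators, unimodular multiples of W(z) (covariant_modulation).  Two such groups,
coming from S1 and S2, commute up to the phase exp(2 pi i d^2 s), where s is, up
to sign, the entry (S1 J S2^T)_jj (weylC, sform_momentum).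

Since f only lies in the domains of the two observables, and not in those of
their products, their commutator cannot be applied to it.  Isometries U and V
with V U = exp(2 i h) U V have no domain problem, and satisfy
sin h (|f|^2 - a^2 - b^2) <= a b as soon as |U f - f| <= a, |V f - f| <= b and
0 <= sin h (commutator_le).  As |exp(i t) - 1| <= |t|, here a and b may be taken to be
2 pi d times the two standard deviations.  Dividing by d^2 and letting d tend to
0 gives the inequality for the coordinate j, with the sharp constant 1/(4 pi)
(coordinate_uncertainty).  The theorem follows by summing over j with the
Cauchy-Schwarz inequality, the squared spread being the sum of the coordinate
variances (spread_sqr).

Covariance is a change of variables in the integral formula
(free_kernel_shift), but this formula only describes T on Schwartz functions, so
that a density argument is needed (L2_density).  The test functions are
u(x) exp(-|x|^2) with u in a class of functions, called tame, which is stable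
under partial derivatives and contains sines and cosines; phase space
translates of test functions are therefore Schwartz.  The class also contains
products of logistic functions, which converge to indicators of products of
rays.  Dynkin's theorem, simple functions and dominated convergence then reach
every square-integrable function. *)

(** * Translation invariance of Lebesgue measure on R^n *)

Section translation_invariance.
Context {R : realType}.
Local Notation leb := (@lebesgue_measure R).

Let shiftR (a : R) : measurableTypeR R -> measurableTypeR R := fun t => (t : R) - a.

Let measurable_shiftR a : measurable_fun setT (shiftR a).
Proof. by apply: measurable_funD => //; exact: measurable_cst. Qed.

Lemma lebesgue_measure_shift (a : R) (A : set R) : measurable A ->
  leb ((fun t => t - a) @^-1` A) = leb A.
Proof.
move=> mA.
have := @lebesgue_measure_unique R (pushforward leb (shiftR a)).
move=> /(_ (measurable_shiftR a) _ A mA) ->//.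
move=> _ [[b c] _ <-]; rewrite /pushforward /=.
rewrite [RHS](_ : _ = leb `]b + a, c + a]); last first.
  congr (leb _); apply/seteqP; split => t /=;
  by rewrite /shiftR !in_itv/= ltrBrDr lerBlDr.
rewrite (lebesgue_measure_itv `]b, c]) (lebesgue_measure_itv `]b + a, c + a]) /=.
by rewrite !lte_fin ltrD2r; case: ifP => // _; rewrite -!EFinB; congr EFin; ring.
Qed.

Lemma ge0_integral_shift (a : R) (f : R -> \bar R) :
  measurable_fun setT f -> (forall t, 0 <= f t)%E ->
  (\int[leb]_t f (t - a)%R = \int[leb]_t f t)%E.
Proof.
move=> mf f0.
rewrite -(@ge0_integral_pushforward _ _ (measurableTypeR R) (measurableTypeR R) R
  (shiftR a) (measurable_shiftR a) leb setT f) //.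
apply: eq_measure_integral => A mA _.
by rewrite /pushforward; exact: lebesgue_measure_shift.
Qed.

Lemma ge0_integral_cVS n (f : 'cV[R]_n.+1 -> \bar R) :
  measurable_fun setT f -> (forall v, 0 <= f v)%E ->
  (\int[lebesgue_cV n.+1]_v f v =
   \int[leb]_t \int[lebesgue_cV n]_v f (cV_cons (t, v)))%E.
Proof.
move=> mf f0.
rewrite (@ge0_integral_pushforward _ _ _ _ R _ (@measurable_cV_cons R n)
  (leb \x lebesgue_cV n)%E setT f) //.
rewrite preimage_setT (@fubini_tonelli1 _ _ _ _ _ leb (lebesgue_cV n) (f \o @cV_cons R n)) //.
by apply: measurableT_comp => //; exact: measurable_cV_cons.
by move=> p; exact: f0.
Qed.

Lemma measurable_cV_shift n (a : 'cV[R]_n) :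
  measurable_fun setT (fun v : 'cV[R]_n => v - a).
Proof.
apply: measurable_fun_mxP => i j.
under eq_fun do rewrite !mxE.
by apply: measurable_funB => //; exact: measurable_mx_coord.
Qed.

Lemma cV_cons_uncons n (v : 'cV[R]_n.+1) : cV_cons (cV_uncons v) = v.
Proof.
apply/matrixP => i j; rewrite ord1.
have [k ->|->] := unliftP ord0 i; last by rewrite cV_cons0.
rewrite (_ : lift ord0 k = rshift 1 k); last exact/val_inj.
by rewrite cV_consS /cV_uncons /= mxE.
Qed.

Lemma cV_consB n (p q : measurableTypeR R * 'cV[R]_n) :
  cV_cons p - cV_cons q = cV_cons ((p.1 : R) - q.1, p.2 - q.2).
Proof.
apply/matrixP => i j; rewrite ord1.
have [k ->|->] := unliftP ord0 i; last first.
  by rewrite mxE [X in _ + X]mxE !cV_cons0.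
rewrite (_ : lift ord0 k = rshift 1 k); last exact/val_inj.
by rewrite mxE [X in _ + X]mxE !cV_consS /= [RHS]mxE [X in _ = _ + X]mxE.
Qed.

(** Induction on the dimension: in the iterated integral the inner integral is
invariant by induction, the outer one by invariance on the line. *)
Lemma ge0_integral_cV_shift n (a : 'cV[R]_n) (f : 'cV[R]_n -> \bar R) :
  measurable_fun setT f -> (forall v, 0 <= f v)%E ->
  (\int[lebesgue_cV n]_v f (v - a)%R = \int[lebesgue_cV n]_v f v)%E.
Proof.
elim: n a f => [|n IH] a f mf f0.
  by apply: eq_integral => v _; congr f; apply/matrixP => -[].
have mcons t : measurable_fun setT (fun v : 'cV[R]_n => @cV_cons R n (t, v)).
  apply: (measurableT_comp (@measurable_cV_cons R n)).
  by apply/measurable_fun_pairP; split; [exact: measurable_cst|exact: measurable_id].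
rewrite !ge0_integral_cVS//; last first.
  by apply: measurableT_comp => //; exact: measurable_cV_shift.
rewrite -[a]cV_cons_uncons; case: (cV_uncons a) => s b.
under eq_integral do under eq_integral do rewrite cV_consB /=.
under eq_integral => t _.
  rewrite (IH b (fun v => f (cV_cons ((t - s, v)))))//; last first.
    by apply: measurableT_comp => //; exact: mcons.
  over.
rewrite (@ge0_integral_shift s (fun t => \int[lebesgue_cV n]_v f (cV_cons (t, v)))%E).
- by [].
- apply: (@measurable_fun_fubini_tonelli_F _ _ (measurableTypeR R) _ _
    (lebesgue_cV n) (f \o @cV_cons R n)) => //.
    by apply: measurableT_comp => //; exact: measurable_cV_cons.
  by move=> p; exact: f0.
- by move=> t; apply: integral_ge0 => v _; exact: f0.
Qed.

(** Through positive and negative parts, which is how the integral is defined. *)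
Lemma Rintegral_cV_shift n (a : 'cV[R]_n) (f : 'cV[R]_n -> R) :
  measurable_fun setT f ->
  \int[lebesgue_cV n]_v f (v - a) = \int[lebesgue_cV n]_v f v.
Proof.
move=> mf; rewrite /Rintegral [in LHS]integralE [in RHS]integralE; congr (fine (_ - _)).
  rewrite -(@ge0_integral_cV_shift n a (EFin \o f)^\+%E) //.
    by apply: eq_integral => v _; rewrite !unlock.
  by apply: measurable_funepos; exact/measurable_EFinP.
rewrite -(@ge0_integral_cV_shift n a (EFin \o f)^\-%E) //.
  by apply: eq_integral => v _; rewrite !unlock.
by apply: measurable_funeneg; exact/measurable_EFinP.
Qed.

Lemma ae_cV_shift n (a : 'cV[R]_n) (P : 'cV[R]_n -> Prop) :
  {ae (lebesgue_cV n), forall v, P v} -> {ae (lebesgue_cV n), forall v, P (v - a)}.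
Proof.
have mpre A : measurable A -> measurable ((fun v : 'cV[R]_n => v - a) @^-1` A).
  by move=> mA; rewrite -[X in measurable X]setTI; exact: measurable_cV_shift.
case=> A [mA A0 PA]; exists ((fun v => v - a) @^-1` A); split.
- exact: mpre.
- transitivity (\int[lebesgue_cV n]_v (\1_A (v - a))%:E)%E.
    rewrite (_ : (fun v => _) = EFin \o \1_((fun v => v - a) @^-1` A)) //.
    by rewrite integral_indic ?setIT//; exact: mpre.
  rewrite (@ge0_integral_cV_shift n a (EFin \o \1_A))//.
    by rewrite integral_indic ?setIT.
  - by apply/measurable_EFinP; exact: measurable_indic.
  - by move=> v; rewrite lee_fin.
- by move=> v /= nP; apply: PA => /= Pv; apply: nP.
Qed.

End translation_invariance.

(** * Complex-valued square-integrable functions *)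

Section complex_facts.
Context {R : realType}.
Implicit Types (w z : R[i]) (s t : R).

Lemma cReD w z : complex.Re (w + z) = complex.Re w + complex.Re z.
Proof. by case: w; case: z. Qed.

Lemma cImD w z : complex.Im (w + z) = complex.Im w + complex.Im z.
Proof. by case: w; case: z. Qed.

Lemma cReM w z : complex.Re (w * z) =
  complex.Re w * complex.Re z - complex.Im w * complex.Im z.
Proof. by case: w; case: z. Qed.

Lemma cImM w z : complex.Im (w * z) =
  complex.Re w * complex.Im z + complex.Im w * complex.Re z.
Proof. by case: w; case: z. Qed.

Lemma complex_ext w z : complex.Re w = complex.Re z ->
  complex.Im w = complex.Im z -> w = z.
Proof. by case: w; case: z => ? ? ? ? /= -> ->. Qed.

Lemma normc_sqr z : normc z ^+ 2 = complex.Re z ^+ 2 + complex.Im z ^+ 2.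
Proof. by case: z => x y; rewrite sqr_sqrtr// addr_ge0// sqr_ge0. Qed.

Lemma normc_ge0 z : 0 <= normc z.
Proof. by case: z => x y; exact: sqrtr_ge0. Qed.

Lemma normc_real t : normc t%:C = `|t|.
Proof. by rewrite /= expr0n addr0 sqrtr_sqr. Qed.

Lemma normc_expi t : normc (expi t) = 1.
Proof. by rewrite /= cos2Dsin2 sqrtr1. Qed.

Lemma expiD s t : expi (s + t) = expi s * expi t.
Proof.
by apply: complex_ext; rewrite ?cReM ?cImM /= ?cosD ?sinD//; ring.
Qed.

Lemma expi0 : expi 0 = 1 :> R[i].
Proof. by rewrite /expi cos0 sin0. Qed.

Lemma normr_le_normc t z : t ^+ 2 <= normc z ^+ 2 -> `|t| <= normc z.
Proof.
move=> h; rewrite -(ler_pXn2r (ltn0Sn 1)) ?nnegrE ?normc_ge0//.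
by rewrite real_normK ?num_real.
Qed.

Lemma Re_le_normc z : `|complex.Re z| <= normc z.
Proof. by apply: normr_le_normc; rewrite normc_sqr lerDl sqr_ge0. Qed.

Lemma Im_le_normc z : `|complex.Im z| <= normc z.
Proof. by apply: normr_le_normc; rewrite normc_sqr lerDr sqr_ge0. Qed.

End complex_facts.

Section complex_measurable.
Context {R : realType} d {T : measurableType d}.
Implicit Types f g : T -> R[i].

Definition Cmeasurable f :=
  measurable_fun setT (fun x => complex.Re (f x)) /\
  measurable_fun setT (fun x => complex.Im (f x)).

Lemma Cmeasurable_cst (a : R[i]) : Cmeasurable (fun=> a).
Proof. by split; exact: measurable_cst. Qed.

Lemma CmeasurableD f g : Cmeasurable f -> Cmeasurable g ->
  Cmeasurable (fun x => f x + g x).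
Proof.
move=> [f1 f2] [g1 g2]; split.
  by under eq_fun do rewrite cReD; exact: measurable_funD.
by under eq_fun do rewrite cImD; exact: measurable_funD.
Qed.

Lemma CmeasurableM f g : Cmeasurable f -> Cmeasurable g ->
  Cmeasurable (fun x => f x * g x).
Proof.
move=> [f1 f2] [g1 g2]; split.
  under eq_fun do rewrite cReM.
  by apply: measurable_funB; exact: measurable_funM.
under eq_fun do rewrite cImM.
by apply: measurable_funD; exact: measurable_funM.
Qed.

Lemma Cmeasurable_real (u : T -> R) : measurable_fun setT u ->
  Cmeasurable (fun x => (u x)%:C).
Proof. by move=> mu; split => //=; exact: measurable_cst. Qed.

Lemma Cmeasurable_expi (u : T -> R) : measurable_fun setT u ->
  Cmeasurable (fun x => expi (u x)).
Proof.
move=> mu; split => /=; apply: measurableT_comp mu => //;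
  apply: continuous_measurable_fun; [exact: continuous_cos|exact: continuous_sin].
Qed.

Lemma measurable_normc_sqr f : Cmeasurable f ->
  measurable_fun setT (fun x => normc (f x) ^+ 2).
Proof.
move=> [f1 f2]; under eq_fun do rewrite normc_sqr.
by apply: measurable_funD; exact: measurable_funX.
Qed.

End complex_measurable.

Section L2_theory.
Context {R : realType} {n : nat}.
Implicit Types (f g h : 'cV[R]_n -> R[i]).
Local Notation lambda := (@lebesgue_cV R n).

Lemma L2_Cmeasurable f : L2 f -> Cmeasurable f.
Proof. by case. Qed.

Lemma L2_integrable f : L2 f ->
  lambda.-integrable setT (EFin \o (fun x => normc (f x) ^+ 2)).
Proof.
move=> [f1 f2 foo]; apply/integrableP; split.
  by apply/measurable_EFinP; exact: measurable_normc_sqr.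
under eq_integral => x _ do rewrite /= ger0_norm ?sqr_ge0//.
exact: foo.
Qed.

Lemma L2_of_integrable f : Cmeasurable f ->
  lambda.-integrable setT (EFin \o (fun x => normc (f x) ^+ 2)) -> L2 f.
Proof.
move=> [mf1 mf2] /integrableP[_ foo]; split => //.
move: foo; under eq_integral => x _ do rewrite /= ger0_norm ?sqr_ge0//.
by [].
Qed.

Lemma L2normsq_EFin f : L2 f ->
  (L2normsq f)%:E = (\int[lambda]_x (normc (f x) ^+ 2)%:E)%E.
Proof.
move=> Lf; rewrite fineK//; have /integrableP[_] := L2_integrable Lf.
by move=> _; apply: integrable_fin_num => //; exact: L2_integrable.
Qed.

Lemma L2_dominated f h : Cmeasurable f -> L2 h ->
  (forall x, normc (f x) <= normc (h x)) -> L2 f.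
Proof.
move=> mf Lh fh; apply: L2_of_integrable => //.
apply: le_integrable (L2_integrable Lh) => //.
  by apply/measurable_EFinP; exact: measurable_normc_sqr.
move=> x _; rewrite /= lee_fin !ger0_norm ?sqr_ge0//.
by rewrite ler_pXn2r ?nnegrE ?normc_ge0.
Qed.

Lemma normc_sqrD (w z : R[i]) :
  normc (w + z) ^+ 2 <= 2 * normc w ^+ 2 + 2 * normc z ^+ 2.
Proof.
rewrite !normc_sqr cReD cImD.
have := sqr_ge0 (complex.Re w - complex.Re z).
have := sqr_ge0 (complex.Im w - complex.Im z).
nra.
Qed.

Lemma L2D f g : L2 f -> L2 g -> L2 (fun x => f x + g x).
Proof.
move=> Lf Lg; have mfg := CmeasurableD (L2_Cmeasurable Lf) (L2_Cmeasurable Lg).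
apply: L2_of_integrable => //.
have : lambda.-integrable setT
    (EFin \o (fun x => 2 * normc (f x) ^+ 2 + 2 * normc (g x) ^+ 2)).
  rewrite (_ : _ \o _ = (fun x => 2%:E * (normc (f x) ^+ 2)%:E) \+
    (fun x => 2%:E * (normc (g x) ^+ 2)%:E))%E//.
  by apply: integrableD => //; apply: integrableZl => //; exact: L2_integrable.
apply: le_integrable => //.
  by apply/measurable_EFinP; exact: measurable_normc_sqr.
move=> x _; rewrite /= lee_fin !ger0_norm ?sqr_ge0 ?normc_sqrD//.
by rewrite addr_ge0// mulr_ge0// sqr_ge0.
Qed.

Lemma L2Z (a : R[i]) f : L2 f -> L2 (fun x => a * f x).
Proof.
move=> Lf; apply: L2_of_integrable.
  by apply: CmeasurableM; [exact: Cmeasurable_cst|exact: L2_Cmeasurable].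
rewrite (_ : _ \o _ = (fun x => (normc a ^+ 2)%:E * (normc (f x) ^+ 2)%:E)%E).
  by apply: integrableZl => //; exact: L2_integrable.
by apply/funext => x; rewrite /= normcM exprMn EFinM.
Qed.

Lemma L2_0 : L2 (fun _ : 'cV[R]_n => 0 : R[i]).
Proof.
split; [exact: measurable_cst|exact: measurable_cst|].
under eq_integral do rewrite normc0 expr0n.
by rewrite integral0.
Qed.

Lemma L2B f g : L2 f -> L2 g -> L2 (fun x => f x - g x).
Proof.
move=> Lf Lg; have := L2D Lf (L2Z (-1) Lg).
by congr L2; apply/funext => x; rewrite mulN1r.
Qed.

Lemma L2_phase (u : 'cV[R]_n -> R) f : measurable_fun setT u -> L2 f ->
  L2 (fun x => expi (u x) * f x).
Proof.
move=> mu Lf; apply: L2_dominated (Lf) _.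
  by apply: CmeasurableM; [exact: Cmeasurable_expi|exact: L2_Cmeasurable].
by move=> x; rewrite normcM normc_expi mul1r.
Qed.

Lemma L2_shift a f : L2 f -> L2 (fun x => f (x - a)).
Proof.
move=> Lf; have [f1 f2 foo] := Lf; split.
- exact: measurableT_comp f1 (measurable_cV_shift a).
- exact: measurableT_comp f2 (measurable_cV_shift a).
- rewrite (@ge0_integral_cV_shift _ _ a (fun x => (normc (f x) ^+ 2)%:E))//.
    by apply/measurable_EFinP; exact: measurable_normc_sqr.
  by move=> x; rewrite lee_fin sqr_ge0.
Qed.

Lemma L2normsq_shift a f : L2 f -> L2normsq (fun x => f (x - a)) = L2normsq f.
Proof.
move=> Lf; rewrite /L2normsq (@Rintegral_cV_shift _ _ a (fun x => normc (f x) ^+ 2))//.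
by apply: measurable_normc_sqr; exact: L2_Cmeasurable.
Qed.

Lemma L2normsq_eq_norm f g : (forall x, normc (f x) = normc (g x)) ->
  L2normsq f = L2normsq g.
Proof. by move=> fg; apply: eq_Rintegral => x _; rewrite fg. Qed.

Lemma L2normsq_ge0 f : 0 <= L2normsq f.
Proof. by apply: Rintegral_ge0 => x _; exact: sqr_ge0. Qed.

Lemma L2normsqZ (a : R[i]) f : L2 f ->
  L2normsq (fun x => a * f x) = normc a ^+ 2 * L2normsq f.
Proof.
move=> Lf; rewrite /L2normsq -RintegralZl//; last exact: L2_integrable.
by apply: eq_Rintegral => x _; rewrite normcM exprMn.
Qed.

Lemma L2normsq_le f g : L2 f -> L2 g ->
  (forall x, normc (f x) <= normc (g x)) -> L2normsq f <= L2normsq g.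
Proof.
move=> Lf Lg fg; apply: le_Rintegral => //; try exact: L2_integrable.
by move=> x _; rewrite ler_pXn2r ?nnegrE ?normc_ge0.
Qed.

Lemma L2normsqD f g : L2 f -> L2 g ->
  L2normsq (fun x => f x + g x) <= 2 * L2normsq f + 2 * L2normsq g.
Proof.
move=> Lf Lg; rewrite /L2normsq -!RintegralZl//; try exact: L2_integrable.
have If : lambda.-integrable setT (EFin \o (fun x => 2 * normc (f x) ^+ 2)).
  by apply: (@integrableZl _ _ _ lambda setT _ 2 (fun x => (normc (f x) ^+ 2)%:E)) => //;
    exact: L2_integrable.
have Ig : lambda.-integrable setT (EFin \o (fun x => 2 * normc (g x) ^+ 2)).
  by apply: (@integrableZl _ _ _ lambda setT _ 2 (fun x => (normc (g x) ^+ 2)%:E)) => //;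
    exact: L2_integrable.
rewrite -RintegralD//; apply: le_Rintegral => //.
- by apply: L2_integrable; exact: L2D.
- exact: (integrableD _ If Ig).
- by move=> x _; exact: normc_sqrD.
Qed.

Lemma L2normsq_aeeq f g : L2 f -> L2 g -> aeeq f g -> L2normsq f = L2normsq g.
Proof.
move=> Lf Lg fg; congr fine; apply: ae_eq_integral => //.
- by apply/measurable_EFinP; apply: measurable_normc_sqr; exact: L2_Cmeasurable.
- by apply/measurable_EFinP; apply: measurable_normc_sqr; exact: L2_Cmeasurable.
- by apply: filterS fg => x -> _.
Qed.

Lemma L2normsq_eq0 f : L2 f -> L2normsq f = 0 -> aeeq f (fun=> 0).
Proof.
move=> Lf f0.
have := L2normsq_EFin Lf; rewrite f0 => /esym f0E.
have mf : measurable_fun setT (EFin \o (fun x => normc (f x) ^+ 2)).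
  by apply/measurable_EFinP; apply: measurable_normc_sqr; exact: L2_Cmeasurable.
have /(_ setT measurableT _ mf) [+ _] := @ae_eq_integral_abs _ _ R lambda.
move=> h; apply: filterS (h _).
  move=> x /(_ I) /= [] /eqP; rewrite sqrf_eq0 => /eqP; exact: eq0_normc.
rewrite -[RHS]f0E; apply: eq_integral => x _.
by rewrite /= ger0_norm// sqr_ge0.
Qed.

Lemma aeeq_trans f g h : aeeq f g -> aeeq g h -> aeeq f h.
Proof. by apply: filterS2 => x -> ->. Qed.

End L2_theory.

(** * Inner product and commutators of isometries *)

Section inner_product.
Context {R : realType} {n : nat}.
Implicit Types (f g h : 'cV[R]_n -> R[i]).
Local Notation lambda := (@lebesgue_cV R n).

(** The real part of the Hermitian inner product.  Its real bilinearity is enough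
below, where complex phases are multiplied into one of the arguments. *)
Definition ip f g : R := \int[lambda]_x
  (complex.Re (f x) * complex.Re (g x) + complex.Im (f x) * complex.Im (g x)).

Lemma ip_integrable f g : L2 f -> L2 g -> lambda.-integrable setT
  (EFin \o (fun x => complex.Re (f x) * complex.Re (g x) +
                     complex.Im (f x) * complex.Im (g x))).
Proof.
move=> Lf Lg; have := integrableD measurableT (L2_integrable Lf) (L2_integrable Lg).
have [f1 f2] := L2_Cmeasurable Lf; have [g1 g2] := L2_Cmeasurable Lg.
apply: le_integrable => //.
  by apply/measurable_EFinP; apply: measurable_funD; exact: measurable_funM.
move=> x _; rewrite /= lee_fin [leRHS]ger0_norm ?addr_ge0 ?sqr_ge0//.
rewrite !normc_sqr ler_norml.
move: (complex.Re _) (complex.Im _) (complex.Re _) (complex.Im _) => p q r s.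
have := sqr_ge0 (p + r); have := sqr_ge0 (q + s).
have := sqr_ge0 (p - r); have := sqr_ge0 (q - s).
by move=> *; apply/andP; split; nra.
Qed.

Lemma ipC f g : ip f g = ip g f.
Proof. by apply: eq_Rintegral => x _; ring. Qed.

Lemma ipZl (t : R) f g : L2 f -> L2 g ->
  ip (fun x => t%:C * f x) g = t * ip f g.
Proof.
move=> Lf Lg; rewrite /ip -RintegralZl//; try exact: ip_integrable.
by apply: eq_Rintegral => x _; rewrite cReM cImM /=; ring.
Qed.

Lemma ipBl f g h : L2 f -> L2 g -> L2 h ->
  ip (fun x => f x - g x) h = ip f h - ip g h.
Proof.
move=> Lf Lg Lh; rewrite /ip -RintegralB//; try exact: ip_integrable.
by apply: eq_Rintegral => x _; rewrite cReD cImD raddfN/= raddfN /=; ring.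
Qed.

Lemma ipBr f g h : L2 f -> L2 g -> L2 h ->
  ip h (fun x => f x - g x) = ip h f - ip h g.
Proof. by move=> *; rewrite ipC ipBl// ![ip _ h]ipC. Qed.

Lemma ipff f : ip f f = L2normsq f.
Proof. by apply: eq_Rintegral => x _; rewrite normc_sqr -!expr2. Qed.

Lemma ip_rotate (w : R[i]) f : L2 f ->
  ip (fun x => w * f x) f = complex.Re w * L2normsq f.
Proof.
move=> Lf; rewrite /L2normsq -RintegralZl//; last exact: L2_integrable.
by apply: eq_Rintegral => x _; rewrite normc_sqr cReM cImM; ring.
Qed.

Lemma L2normsq_subE f g : L2 f -> L2 g ->
  L2normsq (fun x => f x - g x) = L2normsq f - 2 * ip f g + L2normsq g.
Proof.
move=> Lf Lg; rewrite -[LHS]ipff ipBl ?ipBr ?ipff//; try exact: L2B.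
by rewrite [ip g f]ipC; ring.
Qed.

(** Cauchy-Schwarz: the polynomial t |-> |f - t g|^2 is nonnegative. *)
Lemma ip_le_norms f g (a b : R) : L2 f -> L2 g -> 0 <= a -> 0 <= b ->
  L2normsq f <= a ^+ 2 -> L2normsq g <= b ^+ 2 -> ip f g <= a * b.
Proof.
move=> Lf Lg a0 b0 fa gb.
have quad (t : R) : 0 <= L2normsq f - 2 * t * ip f g + t ^+ 2 * L2normsq g.
  have Ltg := L2Z t%:C Lg.
  have := L2normsq_ge0 (fun x => f x - t%:C * g x).
  rewrite L2normsq_subE// L2normsqZ// normc_real -normrX ger0_norm ?sqr_ge0//.
  by rewrite ipC ipZl// ipC mulrA.
have [->|p0] := eqVneq (ip f g) 0; first exact: mulr_ge0.
suff : ip f g ^+ 2 <= (a * b) ^+ 2.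
  move=> h; apply: (le_trans (ler_norm _)).
  by rewrite -(ler_pXn2r (ltn0Sn 1)) ?nnegrE ?mulr_ge0// -normrX ger0_norm ?sqr_ge0.
rewrite exprMn; have g0 := L2normsq_ge0 g; have f0 := L2normsq_ge0 f.
have [g00|g00] := eqVneq (L2normsq g) 0.
  have := quad ((L2normsq f + 1) / (2 * ip f g)).
  rewrite g00 mulr0 addr0 (_ : 2 * _ * _ = L2normsq f + 1); last by field.
  lra.
have {}g0 : 0 < L2normsq g by rewrite lt_neqAle eq_sym g00.
have := quad (ip f g / L2normsq g).
rewrite (_ : _ + _ = (L2normsq f * L2normsq g - ip f g ^+ 2) / L2normsq g); last by field.
rewrite pmulr_lge0 ?invr_gt0// subr_ge0 => /le_trans; apply.
by apply: ler_pM => //; exact: ltW.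
Qed.

End inner_product.

Section commutator.
Context {R : realType} {n : nat}.
Implicit Types (f g h : 'cV[R]_n -> R[i]).

(** Linearity is required pointwise, not merely almost everywhere: the
operators to which this is applied are given by explicit formulas. *)
Record isometric_op (U : ('cV[R]_n -> R[i]) -> ('cV[R]_n -> R[i])) : Prop := {
  isom_L2 : forall f, L2 f -> L2 (U f);
  isom_linear : forall (a : R[i]) f g x,
    U (fun y => a * f y + g y) x = a * U f x + U g x;
  isom_norm : forall f, L2 f -> L2normsq (U f) = L2normsq f }.

Section isometric_op_theory.
Variable U : ('cV[R]_n -> R[i]) -> ('cV[R]_n -> R[i]).
Hypothesis isoU : isometric_op U.

Lemma isomZB (w : R[i]) f g :
  (fun x => U (fun y => w * f y) x - U g x) = U (fun y => w * f y - g y).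
Proof.
apply/funext => x; have U0 : U (fun=> 0) x = 0.
  have := isom_linear isoU 1 (fun=> 0) (fun=> 0) x.
  rewrite (_ : (fun y => _) = (fun=> 0)); last by apply/funext => y; rewrite mulr0 addr0.
  by rewrite mul1r => /eqP; rewrite -subr_eq0 opprD addNKr oppr_eq0 => /eqP.
have -> : (fun y => w * f y - g y) = (fun y => (-1) * g y + w * f y).
  by apply/funext => y; rewrite mulN1r addrC.
by rewrite (isom_linear isoU) mulN1r addrC.
Qed.

Lemma isomZ (w : R[i]) f : (fun x => w * U f x) = U (fun y => w * f y).
Proof.
have := isomZB w f (fun=> 0); have := isomZB 0 (fun=> 0) (fun=> 0).
rewrite (_ : (fun y => 0 * 0 - 0) = (fun=> 0)); last by apply/funext => y; rewrite mul0r subr0.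
rewrite (_ : (fun y => 0 * 0) = (fun=> 0)); last by apply/funext => y; rewrite mul0r.
move=> /esym/funeqP U0 _; apply/funext => x.
have := isom_linear isoU w f (fun=> 0) x.
rewrite U0 subrr addr0 => <-; congr (U _ x).
by apply/funext => y; rewrite addr0.
Qed.

Lemma isomB f g : (fun x => U f x - U g x) = U (fun y => f y - g y).
Proof.
have := isomZB 1 f g.
rewrite (_ : (fun y => 1 * f y) = f); last by apply/funext => y; rewrite mul1r.
rewrite (_ : (fun y => 1 * f y - g y) = (fun y => f y - g y))//.
by apply/funext => y; rewrite mul1r.
Qed.

(** Polarization. *)
Lemma isom_ip f g : L2 f -> L2 g -> ip (U f) (U g) = ip f g.
Proof.
move=> Lf Lg; have Uf := isom_L2 isoU Lf; have Ug := isom_L2 isoU Lg.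
have := L2normsq_subE Uf Ug; rewrite isomB (isom_norm isoU) ?(isom_norm isoU Lf);
  last exact: L2B.
by rewrite (isom_norm isoU Lg) L2normsq_subE//; lra.
Qed.

End isometric_op_theory.

Variables U V : ('cV[R]_n -> R[i]) -> ('cV[R]_n -> R[i]).
Hypotheses (isoU : isometric_op U) (isoV : isometric_op V).

(** The uncertainty principle for a pair of isometries that commute up to a
phase: expanding the inner products of (VU - V) f with (1 - V) f and of
(UV - U) f with (1 - U) f, the isometry property cancels every term except the
commutator (VU - UV) f tested against f.  The rotation by w turns the phase
defect into the positive number 2 sin h. *)
Lemma commutator_le f (h a b : R) : L2 f -> 0 <= a -> 0 <= b ->
  (forall x, V (U f) x = expi (h + h) * U (V f) x) -> 0 <= sin h ->
  L2normsq (fun x => U f x - f x) <= a ^+ 2 ->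
  L2normsq (fun x => V f x - f x) <= b ^+ 2 ->
  sin h * (L2normsq f - (a ^+ 2 + b ^+ 2)) <= a * b.
Proof.
move=> Lf a0 b0 VU sh0 Ua Vb.
have Lu := isom_L2 isoU Lf; have Lv := isom_L2 isoV Lf.
have Luv := isom_L2 isoU Lv; have Lvu := isom_L2 isoV Lu.
pose w : R[i] := (- sin h) +i* (- cos h).
have w1 : normc w = 1.
  by rewrite /= !sqrrN addrC cos2Dsin2 sqrtr1.
have normw g : L2 g -> L2normsq (fun x => w * g x) = L2normsq g.
  by move=> Lg; rewrite L2normsqZ// w1 expr1n mul1r.
(* All terms other than the commutator cancel in this difference. *)
have key : ip (fun x => w * (V (U f) x - V f x)) (fun x => f x - V f x) -
    ip (fun x => w * (U (V f) x - U f x)) (fun x => f x - U f x) =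
    2 * sin h * ip (U (V f)) f.
  have mulwB g1 g2 : (fun x => w * (g1 x - g2 x)) = (fun x => w * g1 x - w * g2 x).
    by apply/funext => x; rewrite mulrBr.
  rewrite !mulwB !ipBl ?ipBr//; try exact: L2Z; try exact: L2B.
  rewrite (isomZ isoV w (U f)) (isomZ isoU w (V f)).
  rewrite (isom_ip isoV _ Lf); last exact: L2Z.
  rewrite (isom_ip isoU _ Lf); last exact: L2Z.
  rewrite -(isomZ isoV w (U f)) -(isomZ isoU w (V f)).
  rewrite (ip_rotate _ Lu) (ip_rotate _ Lv) (isom_norm isoU)// (isom_norm isoV)//.
  have : ip (fun x => w * V (U f) x - w * U (V f) x) f = 2 * sin h * ip (U (V f)) f.
    rewrite -ipZl//; congr (ip _ f); apply/funext => x; rewrite VU mulrA -mulrBl.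
    congr (_ * _); rewrite expiD.
    have := cos2Dsin2 h; rewrite /expi /w => cs.
    apply: complex_ext; rewrite ?cReD ?cImD ?raddfN ?cReM ?cImM /= ?cReM ?cImM /=.
      move: cs; move: (cos h) (sin h) => c s cs.
      rewrite (_ : 2 * s = s * (c ^+ 2 + s ^+ 2) + s); last by rewrite cs; ring.
      by ring.
    move: cs; move: (cos h) (sin h) => c s cs.
    rewrite (_ : 0 = c - c * (c ^+ 2 + s ^+ 2)); last by rewrite cs; ring.
    by ring.
  rewrite ipBl//; try exact: L2Z.
  lra.
have neg g1 g2 : L2 g1 -> L2 g2 ->
    L2normsq (fun x => g1 x - g2 x) = L2normsq (fun x => g2 x - g1 x).
  by move=> L1 L2'; apply: L2normsq_eq_norm => x; rewrite -normcN opprB.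
have le1 : ip (fun x => w * (V (U f) x - V f x)) (fun x => f x - V f x) <= a * b.
  apply: ip_le_norms => //; [by apply: L2Z; exact: L2B|exact: L2B| |].
    rewrite normw; last exact: L2B.
    by rewrite (isomB isoV) (isom_norm isoV)//; exact: L2B.
  by rewrite neg.
have le2 : ip (fun x => - w * (U (V f) x - U f x)) (fun x => f x - U f x) <= a * b.
  rewrite mulrC; apply: ip_le_norms => //; [by apply: L2Z; exact: L2B|exact: L2B| |].
    rewrite L2normsqZ; last exact: L2B.
    rewrite normcN w1 expr1n mul1r.
    by rewrite ?(isomB isoU) ?(isom_norm isoU)//; exact: L2B.
  by rewrite neg.
have {}le2 : - ip (fun x => w * (U (V f) x - U f x)) (fun x => f x - U f x) <= a * b.
  move: le2; congr (_ <= _).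
  rewrite -[RHS]mulN1r -ipZl; [|by apply: L2Z; exact: L2B|exact: L2B].
  congr (ip _ _); apply/funext => x; rewrite mulrA; congr (_ * _).
  by rewrite rmorphN1 mulN1r.
(* U (V f) is close to f, hence its inner product with f is almost |f|^2. *)
have close : L2normsq (fun x => U (V f) x - f x) <= 2 * (a ^+ 2 + b ^+ 2).
  have -> : (fun x => U (V f) x - f x) =
      (fun x => (U (V f) x - U f x) + (U f x - f x)).
    by apply/funext => x; rewrite addrA subrK.
  apply: (le_trans (L2normsqD _ _)); [exact: L2B|exact: L2B|].
  rewrite (isomB isoU) (isom_norm isoU); last exact: L2B.
  by lra.
have := close; rewrite L2normsq_subE// (isom_norm isoU)// (isom_norm isoV)// => close'.
have : L2normsq f - (a ^+ 2 + b ^+ 2) <= ip (U (V f)) f by lra.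
move=> /(ler_wpM2l sh0) => h1.
by lra.
Qed.

End commutator.

(** * Schwartz test functions *)

Section test_functions.
Context {R : realType} {n : nat}.
Local Notation V := 'cV[R]_n.
Implicit Types (u v : V -> R) (x : V).
Local Notation lambda := (@lebesgue_cV R n).

Lemma dotpDl x y (z : V) : dotp (x + y) z = dotp x z + dotp y z.
Proof. by rewrite /dotp -big_split; apply: eq_bigr => i _; rewrite mxE mulrDl. Qed.

Lemma dotpC x y : dotp x y = dotp y x.
Proof. by apply: eq_bigr => i _; rewrite mulrC. Qed.

Lemma dotpDr x y (z : V) : dotp z (x + y) = dotp z x + dotp z y.
Proof. by rewrite dotpC dotpDl !(dotpC z). Qed.

Lemma dotpZl (t : R) x y : dotp (t *: x) y = t * dotp x y.
Proof. by rewrite /dotp mulr_sumr; apply: eq_bigr => i _; rewrite mxE mulrA. Qed.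

Lemma dotpNl x y : dotp (- x) y = - dotp x y.
Proof. by rewrite -scaleN1r dotpZl mulN1r. Qed.

Lemma dotpNr x y : dotp x (- y) = - dotp x y.
Proof. by rewrite dotpC dotpNl dotpC. Qed.

Lemma dotp_ge0 x : 0 <= dotp x x.
Proof. by apply: sumr_ge0 => i _; rewrite -expr2 sqr_ge0. Qed.

Lemma dotp_coord x i : x i 0 ^+ 2 <= dotp x x.
Proof.
rewrite /dotp (bigD1 i)//= -expr2 lerDl.
by apply: sumr_ge0 => j _; rewrite -expr2 sqr_ge0.
Qed.

Lemma measurable_dotp (b : V) : measurable_fun setT (fun x => dotp b x).
Proof.
apply: measurable_sum => i; apply: measurable_funM; first exact: measurable_cst.
exact: measurable_mx_coord.
Qed.

(** A bounded function whose derivative is a polynomial in the function itself,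
and whose steep versions approach indicators of rays. *)
Definition logistic (t : R) : R := (1 + expR t)^-1.

Lemma logistic_den (t : R) : 0 < 1 + expR t.
Proof. by rewrite addr_gt0// expR_gt0. Qed.

Lemma logistic_ge0 t : 0 <= logistic t.
Proof. by rewrite invr_ge0 ltW// logistic_den. Qed.

Lemma logistic_le1 t : logistic t <= 1.
Proof. by rewrite invf_le1 ?logistic_den// lerDl expR_ge0. Qed.

Lemma is_derive_logistic (t : R) :
  is_derive t 1 logistic (- (logistic t * (1 - logistic t))).
Proof.
have d := logistic_den t.
have dV : derivable (fun s : R => 1 + expR s) t 1 by [].
apply: DeriveDef; first by apply: derivableV => //; rewrite gt_eqF.
rewrite /logistic deriveV ?gt_eqF// deriveD// derive_cst add0r derive_val.
rewrite /GRing.scale/=; field; by rewrite gt_eqF.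
Qed.

(** A class of functions of polynomial growth that is stable under partial
derivatives; times a Gaussian, its members are Schwartz functions.  It contains
sin and cos for the sake of modulations, and the logistic function for the sake
of the density argument. *)
Inductive tame : (V -> R) -> Prop :=
| tame_cst c : tame (fun=> c)
| tame_coord i : tame (fun x => x i 0)
| tameD u v : tame u -> tame v -> tame (fun x => u x + v x)
| tameM u v : tame u -> tame v -> tame (fun x => u x * v x)
| tame_sin u : tame u -> tame (fun x => sin (u x))
| tame_cos u : tame u -> tame (fun x => cos (u x))
| tame_logistic u : tame u -> tame (fun x => logistic (u x)).

Lemma is_derive_comp_dir (h : R -> R) (dh : R) u x (e : V) (du : R) :
  differentiable u x -> is_derive x e u du -> is_derive (u x) 1 h dh ->
  differentiable (fun y => h (u y)) x /\
  is_derive x e (fun y => h (u y)) (dh * du).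
Proof.
move=> udiff [_ ue] [hder he].
have hdiff : differentiable h (u x) by apply/derivable1_diffP.
have cdiff : differentiable (h \o u) x by exact: differentiable_comp.
split => //; apply: DeriveDef; first exact: diff_derivable.
have ue' : 'd u x e = du by rewrite -deriveE.
rewrite deriveE// diff_comp//= ue'.
by rewrite diff1E//= derive1E he /GRing.scale/= mulrC.
Qed.

Lemma tame_derive u : tame u -> (forall x, differentiable u x) /\
  (forall j, exists2 u', tame u' &
     forall x, is_derive x (delta_mx j 0) u (u' x)).
Proof.
elim => {u} [c|i|u v tu [du pu] tv [dv pv]|u v tu [du pu] tv [dv pv]
  |u tu [du pu]|u tu [du pu]|u tu [du pu]].
- split=> [x|j]; first exact: differentiable_cst.
  by exists (fun=> 0); [exact: tame_cst|move=> x; exact: is_derive_cst].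
- split=> [x|j]; first exact: differentiable_coord.
  exists (fun=> (i == j)%:R); first exact: tame_cst.
  move=> x; apply: DeriveDef; first by apply: diff_derivable; exact: differentiable_coord.
  rewrite /derive; apply/cvg_lim => //.
  apply: (@cvg_trans _ ((fun=> (i == j)%:R : R) @ 0^')); last exact: cvg_cst.
  apply: near_eq_cvg; near=> h.
  have h0 : h != 0 by near: h; exact: nbhs_dnbhs_neq.
  by rewrite /= !mxE eqxx andbT addrK /GRing.scale/= mulKf.
- split=> [x|j]; first exact: differentiableD.
  have [u' tu' pu'] := pu j; have [v' tv' pv'] := pv j.
  by exists (fun x => u' x + v' x); [exact: tameD|move=> x; exact: is_deriveD].
- split=> [x|j]; first exact: differentiableM.
  have [u' tu' pu'] := pu j; have [v' tv' pv'] := pv j.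
  exists (fun x => u x * v' x + v x * u' x).
    by apply: tameD; exact: tameM.
  by move=> x; exact: is_deriveM.
- split=> [x|j].
    by have [//] := @is_derive_comp_dir sin _ u x 0 _ (du x) (is_derive0 _ _) (is_derive_sin _).
  have [u' tu' pu'] := pu j; exists (fun x => cos (u x) * u' x).
    by apply: tameM => //; exact: tame_cos.
  by move=> x; have [] := is_derive_comp_dir (du x) (pu' x) (is_derive_sin (u x)).
- split=> [x|j].
    by have [//] := @is_derive_comp_dir cos _ u x 0 _ (du x) (is_derive0 _ _) (is_derive_cos _).
  have [u' tu' pu'] := pu j; exists (fun x => (-1 * sin (u x)) * u' x).
    by apply: tameM => //; apply: tameM; [exact: tame_cst|exact: tame_sin].
  move=> x; rewrite mulN1r.
  by have [] := is_derive_comp_dir (du x) (pu' x) (is_derive_cos (u x)).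
- split=> [x|j].
    by have [//] := @is_derive_comp_dir logistic _ u x 0 _ (du x) (is_derive0 _ _)
      (is_derive_logistic _).
  have [u' tu' pu'] := pu j.
  exists (fun x => (-1 * (logistic (u x) * (1 + -1 * logistic (u x)))) * u' x).
    have tl := tame_logistic tu.
    have tlN : tame (fun x => -1 * logistic (u x)).
      by apply: tameM => //; exact: tame_cst.
    apply: tameM => //; apply: tameM; first exact: tame_cst.
    by apply: tameM => //; apply: tameD => //; exact: tame_cst.
  move=> x; rewrite !mulN1r.
  by have [] := is_derive_comp_dir (du x) (pu' x) (is_derive_logistic (u x)).
Unshelve. all: by end_near. Qed.

Lemma tame_growth u : tame u ->
  exists C k, 0 <= C /\ forall x, `|u x| <= C * (1 + dotp x x) ^+ k.
Proof.
have D1 x : 1 <= 1 + dotp x x by rewrite lerDl dotp_ge0.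
have D0 x : 0 <= 1 + dotp x x by exact: le_trans ler01 (D1 x).
elim => {u} [c|i|u v _ [C [k [C0 pu]]] _ [D [m [DD pv]]]
  |u v _ [C [k [C0 pu]]] _ [D [m [DD pv]]]|u _ _|u _ _|u _ _].
- by exists `|c|, 0; split => // x; rewrite expr0 mulr1.
- exists 1, 1; split => // x; rewrite expr1 mul1r.
  have := dotp_coord x i; rewrite ler_norml => h.
  by apply/andP; split; nra.
- exists (C + D), (k + m)%N; split => [|x]; first exact: addr_ge0.
  apply: (le_trans (ler_normD _ _)); rewrite mulrDl; apply: lerD.
    apply: (le_trans (pu x)); rewrite ler_wpM2l// exprD.
    by rewrite ler_peMr ?exprn_ege1// exprn_ge0.
  apply: (le_trans (pv x)); rewrite ler_wpM2l// exprD.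
  by rewrite ler_peMl ?exprn_ege1// exprn_ge0.
- exists (C * D), (k + m)%N; split => [|x]; first exact: mulr_ge0.
  by rewrite normrM exprD mulrACA; apply: ler_pM.
- by exists 1, 0; split => // x; rewrite mulr1 ler_norml sin_geN1 sin_le1.
- by exists 1, 0; split => // x; rewrite mulr1 ler_norml cos_geN1 cos_le1.
- by exists 1, 0; split => // x; rewrite mulr1 ger0_norm ?logistic_ge0 ?logistic_le1.
Qed.

Lemma tame_shift a u : tame u -> tame (fun x => u (x - a)).
Proof.
elim => {u} [c|i|u v _ tu _ tv|u v _ tu _ tv|u _ tu|u _ tu|u _ tu].
- exact: tame_cst.
- rewrite (_ : (fun x => _) = (fun x => x i 0 + - a i 0)).
    by apply: tameD; [exact: tame_coord|exact: tame_cst].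
  by apply/funext => x; rewrite !mxE.
- exact: tameD.
- exact: tameM.
- exact: tame_sin.
- exact: tame_cos.
- exact: tame_logistic.
Qed.

Lemma tame_sum (I : Type) (s : seq I) (F : I -> V -> R) :
  (forall i, tame (F i)) -> tame (fun x => \sum_(i <- s) F i x).
Proof.
move=> tF; elim: s => [|i s IH].
  by rewrite (_ : (fun x => _) = fun=> 0); [exact: tame_cst|apply/funext => x; rewrite big_nil].
rewrite (_ : (fun x => _) = fun x => F i x + \sum_(j <- s) F j x).
  exact: tameD.
by apply/funext => x; rewrite big_cons.
Qed.

Lemma tame_prod (I : Type) (s : seq I) (F : I -> V -> R) :
  (forall i, tame (F i)) -> tame (fun x => \prod_(i <- s) F i x).
Proof.
move=> tF; elim: s => [|i s IH].
  by rewrite (_ : (fun x => _) = fun=> 1); [exact: tame_cst|apply/funext => x; rewrite big_nil].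
rewrite (_ : (fun x => _) = fun x => F i x * \prod_(j <- s) F j x).
  exact: tameM.
by apply/funext => x; rewrite big_cons.
Qed.

Lemma tame_dotp (b : V) : tame (fun x => dotp b x).
Proof.
by apply: tame_sum => i; apply: tameM; [exact: tame_cst|exact: tame_coord].
Qed.

Lemma tame_sqnorm a : tame (fun x => dotp (x - a) (x - a)).
Proof.
apply: (@tame_shift a (fun x => dotp x x)).
by apply: tame_sum => i; apply: tameM; exact: tame_coord.
Qed.

Lemma tame_measurable u : tame u -> measurable_fun setT u.
Proof.
elim => {u} [c|i|u v _ tu _ tv|u v _ tu _ tv|u _ tu|u _ tu|u _ tu].
- exact: measurable_cst.
- exact: measurable_mx_coord.
- exact: measurable_funD.
- exact: measurable_funM.
- apply: measurableT_comp tu.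
  by apply: continuous_measurable_fun; exact: continuous_sin.
- apply: measurableT_comp tu.
  by apply: continuous_measurable_fun; exact: continuous_cos.
- apply: measurableT_comp tu.
  apply: continuous_measurable_fun => t; apply: differentiable_continuous.
  by apply/derivable1_diffP; have [] := is_derive_logistic t.
Qed.

Definition gauss (x : V) : R := expR (- dotp x x).

Lemma gauss_gt0 x : 0 < gauss x. Proof. exact: expR_gt0. Qed.

Lemma gauss_le1 x : gauss x <= 1.
Proof. by rewrite -expR0 ler_expR oppr_le0 dotp_ge0. Qed.

(** From 1 + t <= (k + 1) (1 + t / (k + 1)) <= (k + 1) exp(t / (k + 1)). *)
Lemma poly_expR_bound (k : nat) : exists2 M : R, 0 <= M &
  forall t, 0 <= t -> (1 + t) ^+ k * expR (- t) <= M.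
Proof.
exists (k.+1%:R ^+ k.+1); first by rewrite exprn_ge0.
move=> t t0; rewrite expRN ler_pdivrMr ?expR_gt0//.
have t1 : 1 <= 1 + t by rewrite lerDl.
apply: (@le_trans _ _ ((1 + t) ^+ k.+1)).
  by rewrite exprS ler_peMl// exprn_ge0// (le_trans ler01).
have -> : expR t = expR (t / k.+1%:R) ^+ k.+1.
  by rewrite -expRM_natr divfK// pnatr_eq0.
rewrite -exprMn ler_pXn2r ?nnegrE ?mulr_ge0 ?expR_ge0 ?(le_trans ler01)//.
apply: (@le_trans _ _ (k.+1%:R * (1 + t / k.+1%:R))); last first.
  by rewrite ler_wpM2l// expR_ge1Dx.
rewrite mulrDr mulr1 mulrC divfK ?pnatr_eq0// lerD2r ler1n.
- by [].
- by rewrite ler1n.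
Qed.

Lemma gauss_decay a (k : nat) : exists M : R, forall x,
  (1 + dotp x x) ^+ k * gauss (x - a) <= M.
Proof.
have [M M0 PM] := poly_expR_bound k.
pose K := 2 + 2 * dotp a a.
have K0 : 0 <= K by rewrite addr_ge0// mulr_ge0// dotp_ge0.
exists (K ^+ k * M) => x.
have q0 := dotp_ge0 (x - a).
apply: le_trans (ler_wpM2l (exprn_ge0 k K0) (PM _ q0)).
rewrite mulrA ler_wpM2r ?expR_ge0// -exprMn.
apply: lerXn2r.
- by rewrite nnegrE addr_ge0 ?dotp_ge0.
- by rewrite nnegrE mulr_ge0// addr_ge0.
have : dotp x x <= 2 * dotp (x - a) (x - a) + 2 * dotp a a.
  have : 0 <= dotp (x - a - a) (x - a - a) by exact: dotp_ge0.
  rewrite !(dotpDl, dotpDr, dotpNl, dotpNr) (dotpC a x); lra.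
have := dotp_ge0 a; rewrite /K; nra.
Qed.

Lemma is_derive_gauss a j x (q' : R) :
  is_derive x (delta_mx j 0) (fun y => dotp (y - a) (y - a)) q' ->
  differentiable (fun y => gauss (y - a)) x /\
  is_derive x (delta_mx j 0) (fun y => gauss (y - a)) (- (q' * gauss (x - a))).
Proof.
move=> dq; have [qd _] := tame_derive (tame_sqnorm a).
have -> : - (q' * gauss (x - a)) = gauss (x - a) * - q' by ring.
apply: (@is_derive_comp_dir expR (gauss (x - a))
  (fun y => - dotp (y - a) (y - a)) x (delta_mx j 0) (- q')).
exact: differentiableN.
Qed.

(** The derivative of v exp(-q) is (v' - v q') exp(-q), and q is tame. *)
Lemma tame_gauss_partials a u (s : seq 'I_n) : tame u -> exists2 v, tame v &
  partials s (fun x => u x * gauss (x - a)) = (fun x => v x * gauss (x - a)).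
Proof.
move=> tu; elim: s => [|j s [v tv IH]]; first by exists u.
have [dv pv] := tame_derive tv; have [v' tv' pv'] := pv j.
have [dq pq] := tame_derive (tame_sqnorm a); have [q' tq' pq'] := pq j.
exists (fun x => v' x + -1 * (v x * q' x)).
  by apply: tameD => //; apply: tameM; [exact: tame_cst|exact: tameM].
rewrite /= IH; apply/funext => x.
have [_ dg] := is_derive_gauss (pq' x).
have d := pv' x.
rewrite (_ : (fun x => _) = v * (fun y => gauss (y - a)))// derive_val.
by rewrite /GRing.scale/=; ring.
Qed.

Lemma tame_gauss_regular a u : tame u ->
  smooth (fun x => u x * gauss (x - a)) /\
  rapidly_decreasing (fun x => u x * gauss (x - a)).
Proof.
move=> tu; split => [s|s k]; have [v tv ->] := tame_gauss_partials a s tu.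
- have [dv pv] := tame_derive tv.
  have [dq pq] := tame_derive (tame_sqnorm a).
  have dg x : differentiable (fun y => gauss (y - a)) x.
    apply: (@differentiable_comp _ _ _ _ (fun y => - dotp (y - a) (y - a)) expR).
      exact: differentiableN.
    by apply/derivable1_diffP.
  have dd x : differentiable (fun x => v x * gauss (x - a)) x by exact: differentiableM.
  split=> [x|j x]; first exact: differentiable_continuous.
  exact: diff_derivable.
- have [C [m [C0 pC]]] := tame_growth tv.
  have [M PM] := gauss_decay a (k + m); exists (C * M) => x.
  rewrite normrM (gtr0_norm (gauss_gt0 _)).
  apply: le_trans (ler_wpM2l C0 (PM x)); rewrite exprD !mulrA.
  rewrite ler_wpM2r ?(ltW (gauss_gt0 _))// mulrC [C * _]mulrC -mulrA mulrC.
  have e0 : 0 <= enorm x by exact: sqrtr_ge0.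
  have enorm_le : enorm x <= 1 + dotp x x.
    have := sqr_sqrtr (dotp_ge0 x); rewrite -/(enorm x) => E; nra.
  apply: ler_pM => //; first exact: exprn_ge0.
  by apply: lerXn2r; rewrite ?nnegrE ?addr_ge0 ?dotp_ge0.
Qed.

End test_functions.

Section gauss_integral.
Context {R : realType}.

Lemma measurable_gauss n : measurable_fun setT (@gauss R n).
Proof.
apply: (measurableT_comp (@measurable_expR R)).
apply: measurable_funN; apply: tame_measurable.
by apply: tame_sum => i; apply: tameM; exact: tame_coord.
Qed.

Lemma gauss_cV_cons n (t : R) (v : 'cV[R]_n) :
  gauss (cV_cons (t, v)) = gauss_fun t * gauss v.
Proof.
rewrite /gauss /gauss_fun -expRD; congr expR.
rewrite /dotp big_ord_recl cV_cons0 opprD -expr2; congr (_ - _).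
apply: eq_bigr => i _.
by rewrite (_ : lift ord0 i = rshift 1 i) ?cV_consS//; exact/val_inj.
Qed.

(** By separation of variables, from the one-dimensional Gaussian integral. *)
Lemma gauss_integrable n : (lebesgue_cV n).-integrable setT (EFin \o @gauss R n).
Proof.
have mg m : measurable_fun setT (EFin \o @gauss R m).
  by apply/measurable_EFinP; exact: measurable_gauss.
apply/integrableP; split; first exact: mg.
under eq_integral => x _ do rewrite /= gtr0_norm ?gauss_gt0//.
elim: n => [|n IH].
  rewrite /= integral_dirac//; last exact: mg.
  by rewrite diracE in_setT mul1e ltry.
rewrite ge0_integral_cVS//; last by move=> v; rewrite lee_fin ltW// gauss_gt0.
under eq_integral => t _.
  under eq_integral do rewrite gauss_cV_cons EFinM.
  rewrite ge0_integralZl//; last 3 first.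
  - exact: mg.
  - by move=> v _; rewrite lee_fin ltW// gauss_gt0.
  - by rewrite lee_fin gauss_fun_ge0.
  over.
rewrite /= ge0_integralZr//; last 3 first.
- by apply/measurable_EFinP; exact: measurable_gauss_fun.
- by move=> t _; rewrite lee_fin gauss_fun_ge0.
- by apply: integral_ge0 => v _; rewrite lee_fin ltW// gauss_gt0.
apply: lte_mul_pinfty => //.
- by apply: integral_ge0 => t _; rewrite lee_fin gauss_fun_ge0.
- by apply: integrable_fin_num => //; exact: integrableT_gauss.
Qed.

End gauss_integral.

Section phase_space_shift.
Context {R : realType} {n : nat}.
Local Notation V := 'cV[R]_n.
Implicit Types (f g : V -> R[i]) (x a b : V) (z : 'cV[R]_(n + n)).
Local Notation lambda := (@lebesgue_cV R n).

(** The Weyl operator of the phase space point z = (a, b), up to a phase. *)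
Definition weyl z f : V -> R[i] :=
  fun x => expi (2 * pi * dotp (dsubmx z) x) * f (x - usubmx z).

Definition real_test (u : V -> R) : V -> R[i] := fun x => (u x * gauss x)%:C.

Lemma real_test_L2 (u : V -> R) (M : R) : measurable_fun setT u -> (forall x, `|u x| <= M) -> L2 (real_test u).
Proof.
move=> mu uM.
have M0 : 0 <= M by exact: le_trans (normr_ge0 _) (uM 0).
have mug : measurable_fun setT (fun x => u x * gauss x).
  by apply: measurable_funM => //; exact: measurable_gauss.
apply: L2_of_integrable; first exact: Cmeasurable_real.
have -> : (fun x => normc (real_test u x) ^+ 2) = (fun x => (u x * gauss x) ^+ 2).
  by apply/funext => x; rewrite normc_real -normrX ger0_norm ?sqr_ge0.
have := @integrableZl _ _ _ lambda setT measurableT (M ^+ 2) _ (gauss_integrable n).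
apply: le_integrable => //.
  by apply/measurable_EFinP; exact: measurable_funX.
move=> x _; rewrite /= !lee_fin.
have g0 := gauss_gt0 x; have g1 := gauss_le1 x.
rewrite ger0_norm ?sqr_ge0// ger0_norm; last by rewrite mulr_ge0 ?sqr_ge0 ?ltW.
rewrite exprMn; apply: ler_pM; rewrite ?sqr_ge0//.
  by rewrite -[u x ^+ 2]ger0_norm ?sqr_ge0// normrX; apply: lerXn2r; rewrite ?nnegrE.
by rewrite expr2 ler_piMr// ltW.
Qed.

(** Both components of a modulated translate are tame functions times a
translated Gaussian: this is why tame functions include sin and cos. *)
Lemma weyl_real_test_schwartz z u : tame u -> schwartz (weyl z (real_test u)).
Proof.
move=> tu; set a := usubmx z; set b := dsubmx z.
have tl : tame (fun x => 2 * pi * dotp b x).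
  by apply: tameM; [exact: tame_cst|exact: tame_dotp].
have ReE : (fun x => complex.Re (weyl z (real_test u) x)) =
    (fun x => (cos (2 * pi * dotp b x) * u (x - a)) * gauss (x - a)).
  by apply/funext => x; rewrite /weyl /real_test cReM /=; ring.
have ImE : (fun x => complex.Im (weyl z (real_test u) x)) =
    (fun x => (sin (2 * pi * dotp b x) * u (x - a)) * gauss (x - a)).
  by apply/funext => x; rewrite /weyl /real_test cImM /=; ring.
have tc : tame (fun x => cos (2 * pi * dotp b x) * u (x - a)).
  by apply: tameM; [exact: tame_cos|exact: tame_shift].
have ts : tame (fun x => sin (2 * pi * dotp b x) * u (x - a)).
  by apply: tameM; [exact: tame_sin|exact: tame_shift].
have [c1 c2] := tame_gauss_regular a tc; have [s1 s2] := tame_gauss_regular a ts.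
by split; rewrite ?ReE ?ImE.
Qed.

Lemma weyl0 f : weyl 0 f = f.
Proof.
apply/funext => x; rewrite /weyl.
have -> : usubmx (0 : 'cV[R]_(n + n)) = 0 by apply/matrixP => i j; rewrite !mxE.
have -> : dotp (dsubmx (0 : 'cV[R]_(n + n))) x = 0.
  by rewrite /dotp big1// => i _; rewrite !mxE mul0r.
by rewrite subr0 mulr0 expi0 mul1r.
Qed.

End phase_space_shift.

(** * Density of the test functions *)

Section ray_boxes.
Context {R : realType}.

Lemma logistic_le (t : R) (k : nat) : k%:R <= t -> logistic t <= harmonic k.
Proof.
move=> kt; rewrite /logistic /harmonic lef_pV2 ?posrE ?logistic_den//.
rewrite -natr1 addrC lerD2l (le_trans kt)//.
by apply: le_trans (expR_ge1Dx t); rewrite lerDr.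
Qed.

Lemma logistic_opp (t : R) : logistic (- t) = 1 - logistic t.
Proof.
rewrite /logistic expRN; have := expR_gt0 t => e0; field.
by rewrite !gt_eqF// addr_gt0.
Qed.

(** The summand k makes the limit the indicator of an open ray at every point,
the endpoint included. *)
Lemma cvg_logistic (s : R) :
  logistic (k%:R ^+ 2 * s + k%:R) @[k --> \oo] --> ((s < 0)%R%:R : R).
Proof.
have [s0|s0] := ltP s 0.
- rewrite (_ : (fun k => _) = (fun k : nat =>
    1 - logistic (- (k%:R ^+ 2 * s + k%:R)))); last first.
    by apply/funext => k; rewrite -logistic_opp opprK.
  rewrite -[X in _ --> X]subr0; apply: cvgB; first exact: cvg_cst.
  apply: (@squeeze_cvgr _ _ _ _ (cst 0) (@harmonic R)); last 2 first.
    exact: cvg_cst.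
    exact: cvg_harmonic.
  near=> k; rewrite /= logistic_ge0/=; apply: logistic_le.
  have k2 : - 2 / s <= k%:R.
    by near: k; exact: nbhs_infty_ger.
  have k0 : 0 <= k%:R :> R by [].
  move: k2; rewrite ler_ndivrMr// => k2; nra.
- apply: (@squeeze_cvgr _ _ _ _ (cst 0) (@harmonic R)); last 2 first.
    exact: cvg_cst.
    exact: cvg_harmonic.
  near=> k; rewrite /= logistic_ge0/=; apply: logistic_le.
  by rewrite lerDr mulr_ge0// exprn_ge0.
Unshelve. all: by end_near. Qed.

Lemma cvg_prodr (I : Type) (s : seq I) (F : I -> nat -> R) (l : I -> R) :
  (forall i, F i k @[k --> \oo] --> l i) ->
  (\prod_(i <- s) F i k) @[k --> \oo] --> \prod_(i <- s) l i.
Proof.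
move=> Fl; elim: s => [|i s IH].
  by under eq_fun do rewrite big_nil; rewrite big_nil; exact: cvg_cst.
under eq_fun do rewrite big_cons; rewrite big_cons; exact: cvgM.
Qed.

Definition ray_box n (c : 'cV[R]_n) : set 'cV[R]_n :=
  [set v | forall i, v i 0 < c i 0].

Lemma indic_ray_box n (c v : 'cV[R]_n) :
  \1_(ray_box c) v = \prod_(i < n) ((v i 0 < c i 0)%R%:R) :> R.
Proof.
rewrite indicE; have [vc|vc] := boolP (v \in ray_box c).
  by rewrite big1// => i _; move: vc; rewrite inE => /(_ i) ->.
move: vc; rewrite notin_setE /ray_box/= -existsNE => -[i /negP /negbTE vi].
by rewrite (bigD1 i)//= vi mul0r.
Qed.

(** A half-space is the increasing union of the boxes whose other rays end at N. *)
Lemma cV_measurable_ray_box n :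
  @measurable _ 'cV[R]_n = <<s [set A | exists c, A = ray_box c] >>.
Proof.
set G := [set A | exists c : 'cV[R]_n, A = ray_box c].
have mG c : measurable (ray_box c : set 'cV[R]_n).
  rewrite (_ : ray_box c = \bigcap_(i in [set: 'I_n])
     ((fun v : 'cV[R]_n => v i 0) @^-1` `]-oo, c i 0[%classic)); last first.
    apply/seteqP; split => [v vc i _|v vc i]; first by rewrite /= in_itv/=; exact: vc.
    by have := vc i I; rewrite /= in_itv.
  apply: fin_bigcap_measurable => // i _; rewrite -[X in measurable X]setTI.
  by apply: measurable_mx_coord => //; exact: measurable_itv.
apply/seteqP; split; last first.
  apply: smallest_sub; last by move=> _ [c ->]; exact: mG.
  exact: sigma_algebra_measurable.
apply: smallest_sub; first exact: smallest_sigma_algebra.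
move=> _ [[i j] _ [Y mY <-]] /=; rewrite setTI (ord1 j).
pose T' := g_sigma_algebraType G.
have : measurable_fun [set: T'] ((fun v : 'cV[R]_n => v i 0) : T' -> measurableTypeR R).
  apply: (@measurability _ _ T' (measurableTypeR R) _ _ (@RGenInftyO.G R)).
    exact: RGenInftyO.measurableE.
  move=> _ [_ [c ->] <-]; rewrite setTI.
  rewrite (_ : _ @^-1` _ = \bigcup_(N in [set: nat])
      ray_box (\col_k if k == i then c else N%:R)); last first.
    apply/seteqP; split => v /=; rewrite in_itv/= => vc; last first.
      by case: vc => N _ /(_ i); rewrite mxE eqxx.
    exists (Num.trunc (\sum_k `|v k 0|)).+1 => // k; rewrite mxE.
    case: eqP => [->//|_].
    apply: le_lt_trans (truncnS_gt _).
    rewrite (bigD1 k)//= (le_trans (ler_norm _))// lerDl.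
    by apply: sumr_ge0.
  apply: bigcup_measurable => N _; apply: sub_sigma_algebra.
  by eexists.
by move=> /(_ measurableT Y mY); rewrite setTI.
Qed.

End ray_boxes.

Import HBNNSimple.

Section density.
Context {R : realType} {n : nat}.
Local Notation V := 'cV[R]_n.
Local Notation lambda := (@lebesgue_cV R n).
Variable P : (V -> R[i]) -> Prop.

(** Limits are taken of real functions: complex ones are recovered at the end from
their real and imaginary parts. *)
Hypothesis P_test : forall u M, tame u -> (forall x, `|u x| <= M) ->
  P (real_test u).
Hypothesis P_linear : forall a f g, L2 f -> L2 g -> P f -> P g ->
  P (fun x => a * f x + g x).
Hypothesis P_lim : forall (F : nat -> V -> R) (f h : V -> R),
  (forall k, L2 (fun x => (F k x)%:C)) -> L2 (fun x => (h x)%:C) ->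
  (forall k x, `|F k x| <= h x) ->
  (forall x, F k x @[k --> \oo] --> f x) ->
  (forall k, P (fun x => (F k x)%:C)) -> P (fun x => (f x)%:C).

Let P_addr (u v : V -> R) (a : R) :
  L2 (real_test u) -> L2 (real_test v) -> P (real_test u) -> P (real_test v) ->
  P (real_test (fun x => a * u x + v x)).
Proof.
move=> Lu Lv Pu Pv; have := P_linear a%:C Lu Lv Pu Pv; congr P.
by apply/funext => x; rewrite /real_test -!rmorphM -rmorphD/= mulrDl mulrA.
Qed.

Let P_test_lim (F : nat -> V -> R) (f : V -> R) (M : R) :
  (forall k, measurable_fun setT (F k)) -> (forall k x, `|F k x| <= M) ->
  (forall x, F k x @[k --> \oo] --> f x) ->
  (forall k, P (real_test (F k))) -> P (real_test f).
Proof.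
move=> mF FM Ff PF.
apply: (P_lim (F := fun k x => F k x * gauss x) (h := fun x => M * gauss x)) => //.
- by move=> k; exact: (real_test_L2 (M := M)).
- by apply: (@real_test_L2 _ _ _ `|M|) => //; exact: measurable_cst.
- move=> k x; rewrite normrM (gtr0_norm (gauss_gt0 x)).
  by rewrite ler_wpM2r// ltW// gauss_gt0.
- by move=> x; apply: cvgM; [exact: Ff|exact: cvg_cst].
Qed.

Let L2_indic (A : set V) : measurable A -> L2 (real_test \1_A).
Proof.
move=> mA; apply: (@real_test_L2 _ _ _ 1); first exact: measurable_indic.
by move=> x; rewrite indicE; case: (_ \in _); rewrite ?normr1 ?normr0.
Qed.

Let P_ray_box (c : V) : P (real_test \1_(ray_box c)).
Proof.
pose F (k : nat) (x : V) :=
  \prod_(i < n) logistic (k%:R ^+ 2 * (x i 0 + - c i 0) + k%:R).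
have tF k : tame (F k).
  apply: tame_prod => i; apply: tame_logistic; apply: tameD; last exact: tame_cst.
  apply: tameM; first exact: tame_cst.
  by apply: tameD; [exact: tame_coord|exact: tame_cst].
have FM k x : `|F k x| <= 1.
  rewrite ger0_norm; last by apply: prodr_ge0 => i _; exact: logistic_ge0.
  by apply: prodr_ile1 => i _; rewrite logistic_ge0 logistic_le1.
apply: (@P_test_lim F _ 1) => //.
- by move=> k; exact: tame_measurable.
- move=> x; rewrite indic_ray_box /F.
  by apply: cvg_prodr => i; rewrite -subr_lt0; exact: cvg_logistic.
- by move=> k; apply: (P_test (M := 1)).
Qed.

Let P_indic (A : set V) : measurable A -> P (real_test \1_A).
Proof.
move=> mA.
apply: (@dynkin_induction _ V [set A | exists c, A = ray_box c]
  (fun A => P (real_test \1_A))); last by rewrite -cV_measurable_ray_box.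
- exact: cV_measurable_ray_box.
- move=> _ _ [c ->] [d ->]; exists (\col_i Order.min (c i 0) (d i 0)).
  apply/seteqP; split => v /=.
    by move=> [vc vd] i; rewrite mxE lt_min vc vd.
  by move=> vcd; split => i; have := vcd i; rewrite mxE lt_min => /andP[].
- rewrite indicT; apply: (P_test (M := 1)); first exact: tame_cst.
  by move=> x; rewrite normr1.
- by move=> _ [c ->]; exact: P_ray_box.
- move=> B mB PB.
  have -> : \1_(~` B) = (fun x => -1 * \1_B x + \1_[set: V] x) :> (V -> R).
    apply/funext => x; rewrite !indicE in_setC in_setT.
    by case: (x \in B); rewrite ?mulr1 ?mulr0 ?addNr ?add0r.
  apply: P_addr => //; [exact: L2_indic|exact: L2_indic|].
  rewrite indicT; apply: (P_test (M := 1)); first exact: tame_cst.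
  by move=> x; rewrite normr1.
- move=> F mF tF PF.
  (* Partial sums of indicators of disjoint sets are indicators, hence bounded. *)
  pose S k (x : V) : R := \sum_(i < k) \1_(F i) x.
  have mS k : measurable_fun setT (S k).
    by apply: measurable_sum => i; exact: measurable_indic.
  have S01 k x : S k x = \1_(\bigcup_(i < k) F i) x.
    rewrite bigcup_mkord; elim: k => [|k IH]; first by rewrite /S !big_ord0 indic0.
    rewrite /S !big_ord_recr/= -/(S k x) IH !indicE in_setU.
    have [Fk|] := boolP (x \in F k); last by rewrite orbF addr0.
    rewrite orbT (_ : x \in _ = false) ?add0r//; apply/negbTE/negP.
    rewrite inE -bigcup_mkord => -[i /= ik Fi]; move: Fk; rewrite inE => Fk.
    have ki : i = k by apply: tF => //; exists x.
    by move: ik; rewrite ki ltnn.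
  have SM k x : `|S k x| <= 1.
    by rewrite S01 indicE; case: (_ \in _); rewrite ?normr1 ?normr0.
  apply: (@P_test_lim S _ 1) => //.
    move=> x; apply: cvg_near_cst; rewrite indicE.
    have [|xF] := boolP (x \in \bigcup_k F k).
      rewrite inE => -[k _ Fk]; near=> N; rewrite S01 indicE mem_set//.
      by exists k => //=; near: N; exact: nbhs_infty_gt.
    near=> N; rewrite S01 indicE memNset// => -[k _ Fk].
    by move/negP : xF; apply; rewrite inE; exists k.
  elim=> [|k IH].
    rewrite (_ : S 0 = fun=> 0); last by apply/funext => x; rewrite /S big_ord0.
    by apply: (P_test (M := 0)); [exact: tame_cst|move=> x; rewrite normr0].
  rewrite (_ : S k.+1 = fun x => 1 * \1_(F k) x + S k x); last first.
    by apply/funext => x; rewrite /S big_ord_recr/= mul1r addrC.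
  apply: P_addr => //; first exact: L2_indic.
  exact: (real_test_L2 (M := 1)).
Unshelve. all: by end_near. Qed.

Let P_nnsfun (g : {nnsfun V >-> R}) : L2 (real_test g) /\ P (real_test g).
Proof.
suff H (s : seq R) :
    let h := (fun x => \sum_(y <- s) y * \1_(g @^-1` [set y]) x) : V -> R in
    L2 (real_test h) /\ P (real_test h).
  have := H (fset_set (range g)); congr (L2 (real_test _) /\ P (real_test _));
  apply/funext => x; by rewrite [RHS]fimfunE fsbig_finite.
elim: s => [|y s [LI PI]] /=.
  rewrite (_ : (fun x => _) = fun=> 0); last by apply/funext => x; rewrite big_nil.
  split; last by apply: (P_test (M := 0)); [exact: tame_cst|move=> x; rewrite normr0].
  by apply: (@real_test_L2 _ _ _ 0); [exact: measurable_cst|move=> x; rewrite normr0].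
rewrite (_ : (fun x => _) = fun x => y * \1_(g @^-1` [set y]) x +
    \sum_(z <- s) z * \1_(g @^-1` [set z]) x); last first.
  by apply/funext => x; rewrite big_cons.
have mg : measurable (g @^-1` [set y]) by exact: measurable_funPTI.
split; last by apply: P_addr => //; [exact: L2_indic|exact: P_indic].
have := L2D (L2Z y%:C (L2_indic mg)) LI; congr L2.
by apply/funext => x; rewrite /real_test -!rmorphM -rmorphD/= mulrDl mulrA.
Qed.

Let P_ge0 (r : V -> R) : (forall x, 0 <= r x) -> L2 (fun x => (r x)%:C) ->
  P (fun x => (r x)%:C).
Proof.
move=> r0 Lr; have [mr _] := L2_Cmeasurable Lr.
(* r / gauss is the increasing limit of simple functions g k, so that the
   functions g k * gauss increase to r and are dominated by it. *)
pose q := EFin \o (fun x => r x * expR (dotp x x)).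
have mq : measurable_fun setT q.
  apply/measurable_EFinP; apply: measurable_funM => //.
  apply: (measurableT_comp (@measurable_expR R)); apply: tame_measurable.
  by apply: tame_sum => i; apply: tameM; exact: tame_coord.
have q0 x : [set: V] x -> (0 <= q x)%E.
  by move=> _; rewrite lee_fin mulr_ge0// expR_ge0.
pose g := nnsfun_approx measurableT mq.
have gq x : g k x @[k --> \oo] --> r x * expR (dotp x x).
  by have /fine_cvg := @cvg_nnsfun_approx _ _ _ _ measurableT _ mq q0 x I.
have rE x : r x = r x * expR (dotp x x) * gauss x.
  by rewrite -mulrA -expRD subrr expR0 mulr1.
have le_g k x : g k x * gauss x <= r x.
  rewrite (rE x); apply: ler_wpM2r; first by rewrite ltW// gauss_gt0.
  have nd : nondecreasing_seq (fun k => g k x).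
    by move=> a b ab; exact/lefP/nd_nnsfun_approx.
  have := nondecreasing_cvgn_le nd; rewrite (cvg_lim _ (gq x))//; apply.
  exact: gq.
apply: (P_lim (F := fun k x => g k x * gauss x) (h := r)) => //.
- by move=> k; have [] := P_nnsfun (g k).
- by move=> k x; rewrite ger0_norm// mulr_ge0// ltW// gauss_gt0.
- by move=> x; rewrite (rE x); apply: cvgM; [exact: gq|exact: cvg_cst].
- by move=> k; have [] := P_nnsfun (g k).
Qed.

(** Indicators of boxes are dominated limits of products of logistic functions;
Dynkin's theorem leads to indicators of measurable sets, and simple functions to
the rest.  The Gaussian weight keeps every bounded function square-integrable
along the way. *)
Lemma L2_density f : L2 f -> P f.
Proof.
move=> Lf; have [mf1 mf2] := L2_Cmeasurable Lf.
have P_real (r : V -> R) : L2 (fun x => (r x)%:C) -> P (fun x => (r x)%:C).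
  move=> Lr; have [mr _] := L2_Cmeasurable Lr.
  have dom (s : V -> R) : measurable_fun setT s -> (forall x, `|s x| <= `|r x|) ->
      L2 (fun x => (s x)%:C).
    move=> ms sr; apply: L2_dominated (Lr) _; first exact: Cmeasurable_real.
    by move=> x; rewrite !normc_real.
  have Lp : L2 (fun x => (Order.max (r x) 0)%:C).
    apply: dom; first by apply: measurable_maxr => //; exact: measurable_cst.
    by move=> x; case: (leP (r x) 0) => // _; rewrite normr0.
  have Ln : L2 (fun x => (Order.max (- r x) 0)%:C).
    apply: dom.
      by apply: measurable_maxr; [exact: measurable_funN|exact: measurable_cst].
    by move=> x; case: (leP (- r x) 0) => // _; rewrite ?normr0 ?normrN.
  have -> : (fun x => (r x)%:C) =
      (fun x => (-1) * (Order.max (- r x) 0)%:C + (Order.max (r x) 0)%:C).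
    apply/funext => x; rewrite mulN1r -rmorphN -rmorphD/=; congr (_%:C).
    case: (leP (r x) 0) => r0; last by rewrite maxEle oppr_le0 (ltW r0) oppr0 add0r.
    by rewrite maxEle oppr_le0; case: leP => h; lra.
  by apply: P_linear => //; apply: P_ge0 => // x; rewrite le_max lexx orbT.
have part (s : V -> R) : measurable_fun setT s -> (forall x, `|s x| <= normc (f x)) ->
    L2 (fun x => (s x)%:C).
  move=> ms sf; apply: L2_dominated (Lf) _; first exact: Cmeasurable_real.
  by move=> x; rewrite normc_real.
have L1 : L2 (fun x => (complex.Re (f x))%:C).
  by apply: part => // x; exact: Re_le_normc.
have L2' : L2 (fun x => (complex.Im (f x))%:C).
  by apply: part => // x; exact: Im_le_normc.
have -> : f = (fun x => 'i * (complex.Im (f x))%:C + (complex.Re (f x))%:C).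
  apply/funext => x; apply: complex_ext; rewrite ?cReD ?cImD ?cReM ?cImM/=; ring.
by apply: P_linear => //; exact: P_real.
Qed.

End density.

(** * Quadratic exponents of free kernels *)

Section symplectic_algebra.
Context {R : realType} {n : nat}.
Implicit Types (S : 'M[R]_(n + n)) (M : 'M[R]_n) (x y : 'cV[R]_n).

Lemma dotp_mulmx M x y : dotp x (M *m y) = dotp (M^T *m x) y.
Proof.
rewrite /dotp; under eq_bigr do rewrite mxE mulr_sumr.
rewrite exchange_big; apply: eq_bigr => j _; rewrite mxE mulr_suml.
by apply: eq_bigr => i _; rewrite mxE; ring.
Qed.

Lemma usubmx_mul S (z : 'cV[R]_(n + n)) :
  usubmx (S *m z) = ulsubmx S *m usubmx z + ursubmx S *m dsubmx z.
Proof. by rewrite -{1}[S]submxK -{1}[z]vsubmxK mul_block_col col_mxKu. Qed.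

Lemma dsubmx_mul S (z : 'cV[R]_(n + n)) :
  dsubmx (S *m z) = dlsubmx S *m usubmx z + drsubmx S *m dsubmx z.
Proof. by rewrite -{1}[S]submxK -{1}[z]vsubmxK mul_block_col col_mxKd. Qed.

Lemma symplectic_blocks S : symplectic S ->
  let A := ulsubmx S in let B := ursubmx S in
  let C := dlsubmx S in let D := drsubmx S in
  [/\ A^T *m C = C^T *m A, B^T *m D = D^T *m B & D^T *m A - B^T *m C = 1%:M].
Proof.
move=> hS A B C D; move: hS; rewrite /symplectic -[S]submxK -/A -/B -/C -/D.
rewrite tr_block_mx /Jmx !mulmx_block.
rewrite !(mulmx0, mulmx1, mulmxN, mulmx1, add0r, addr0).
move=> /eq_block_mx[e1 _ e3 e4]; split.
- by apply/eqP; rewrite -subr_eq0 -e1 mulNmx addrC.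
- by apply/eqP; rewrite -subr_eq0 -e4 mulNmx addrC.
- by apply: oppr_inj; rewrite -e3 mulNmx opprB addrC.
Qed.

(** Completing the square in the quadratic exponent of the kernel: translating
x by a and modulating by b amounts to translating xi by a' and modulating by b',
where (a', b') = S (a, b). *)
Lemma free_kernel_shift S (z : 'cV[R]_(n + n)) : symplectic S -> is_free S ->
  exists t : R, forall xi x,
  expi (2 * pi * dotp (dsubmx z) (x + usubmx z)) * free_kernel S xi (x + usubmx z) =
  expi t * expi (2 * pi * dotp (dsubmx (S *m z)) xi) *
    free_kernel S (xi - usubmx (S *m z)) x.
Proof.
move=> hS fS; have [AC BD DABC] := symplectic_blocks hS.
rewrite usubmx_mul dsubmx_mul /free_kernel.
have Bu : ursubmx S \in unitmx by rewrite unitmxE unitfE.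
move: (usubmx z) (dsubmx z) AC BD DABC Bu => a b.
move: (ulsubmx S) (ursubmx S) (dlsubmx S) (drsubmx S) => A B C D AC BD DABC Bu.
set N := invmx B; set P := D *m N; set Q := N *m A.
set a' := A *m a + B *m b; set b' := C *m a + D *m b.
have BtK : B^T *m N^T = 1%:M by rewrite -trmx_mul mulVmx ?trmx1.
have NtK : N^T *m B^T = 1%:M by rewrite -trmx_mul mulmxV ?trmx1.
(* The symplectic relations make P and Q symmetric and express C through P, A
   and N: with these facts the cross terms cancel. *)
have PT : P^T = P.
  have : N^T *m (B^T *m D) *m N = N^T *m (D^T *m B) *m N by rewrite BD.
  by rewrite mulmxA NtK mul1mx -!mulmxA mulmxV// mulmx1 trmx_mul.
have CE : C = P *m A - N^T.
  have : N^T *m (D^T *m A - B^T *m C) = N^T by rewrite DABC mulmx1.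
  rewrite mulmxBr !mulmxA NtK mul1mx -trmx_mul -/P PT => h.
  by rewrite -[in RHS]h opprB addrC subrK.
have QT : Q^T = Q.
  move: AC; rewrite CE mulmxBr [(_ - _)^T]linearB /= trmxK mulmxBl trmx_mul PT mulmxA.
  by move=> /addrI /oppr_inj; rewrite -trmx_mul.
have Na' : N *m a' = Q *m a + b.
  by rewrite mulmxDr !mulmxA mulVmx// mul1mx.
have PB : P *m B = D by rewrite -mulmxA mulVmx// mulmx1.
have Pa' : b' = P *m a' - N^T *m a.
  rewrite /b' CE mulmxDr mulmxBl !mulmxA.
  by rewrite PB addrAC.
clearbody a' b' N P Q.
(* The phase is what remains at xi = 0 and x = 0. *)
exists (pi * (2 * dotp b a + dotp a (Q *m a) - dotp a' (P *m a'))) => xi x.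
rewrite -!expiD; congr expi.
have mulB (M : 'M[R]_n) (u v : 'cV[R]_n) : M *m (u - v) = M *m u - M *m v.
  exact: mulmxBr.
rewrite Pa' !mulB !mulmxDr.
rewrite !(dotpDl, dotpDr, dotpNl, dotpNr).
have Qsym u v : dotp u (Q *m v) = dotp v (Q *m u) by rewrite dotp_mulmx QT dotpC.
have Psym u v : dotp u (P *m v) = dotp v (P *m u) by rewrite dotp_mulmx PT dotpC.
have e1 : dotp x (N *m a') = dotp x (Q *m a) + dotp b x.
  by rewrite Na' dotpDr (dotpC x b).
rewrite (dotpC (P *m a') xi) -(dotp_mulmx N a xi).
rewrite (Qsym a x) (Psym a' xi) e1.
ring.
Qed.

End symplectic_algebra.

(** * Metaplectic covariance *)

Section dominated_L2.
Context {R : realType} {n : nat}.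
Local Notation V := 'cV[R]_n.

Lemma L2_dominated_cvg (F : nat -> V -> R) (f h : V -> R) :
  (forall k, L2 (fun x => (F k x)%:C)) -> L2 (fun x => (h x)%:C) ->
  (forall k x, `|F k x| <= h x) ->
  (forall x, F k x @[k --> \oo] --> f x) ->
  L2 (fun x => (f x)%:C) /\
  L2normsq (fun x => (f x)%:C - (F k x)%:C) @[k --> \oo] --> (0 : R).
Proof.
move=> LF Lh Fh Ff.
have mF k : measurable_fun setT (F k) by have [] := LF k.
have mf : measurable_fun setT f by exact: measurable_fun_cvg mF (fun x _ => Ff x).
have fh x : `|f x| <= h x.
  by apply: (cvgr_to_le (cvg_norm (Ff x))); apply: nearW => k; exact: Fh.
have h0 x : 0 <= h x by exact: le_trans (fh x).
have Lf : L2 (fun x => (f x)%:C).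
  apply: L2_dominated (Lh) _; first exact: Cmeasurable_real.
  by move=> x; rewrite !normc_real (ger0_norm (h0 x)).
split => //.
have normE k x : normc ((f x)%:C - (F k x)%:C) ^+ 2 = (f x - F k x) ^+ 2.
  by rewrite -rmorphB normc_real -normrX ger0_norm ?sqr_ge0.
have Ih : (lebesgue_cV n).-integrable setT (EFin \o (fun x => (2 * h x) ^+ 2)).
  have := L2_integrable (L2Z (2%:C) Lh); congr (_.-integrable _ _).
  by apply/funext => x; rewrite /comp -rmorphM normc_real -normrX ger0_norm ?sqr_ge0.
have := @dominated_cvg _ _ R (lebesgue_cV n) setT measurableT
  (fun k x => ((f x - F k x) ^+ 2)%:E) (cst 0%E) (EFin \o (fun x => (2 * h x) ^+ 2)).
move=> /(_ _ _ _ Ih) dom.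
rewrite /L2normsq /Rintegral -[X in _ --> X]/(fine 0%E); apply: fine_cvg.
rewrite -[X in _ --> X](integral0 (lebesgue_cV n) setT).
under eq_fun do under eq_integral do rewrite normE.
apply: dom => //.
- by move=> k; apply/measurable_EFinP; apply: measurable_funX; exact: measurable_funB.
- move=> x _; apply: cvg_EFin; first exact: nearW.
  rewrite (_ : fine \o _ = (fun k => (f x - F k x) ^+ 2))//.
  rewrite (_ : 0 = (f x - f x) ^+ 2); last by rewrite subrr expr0n.
  apply: (@cvg_comp _ _ _ (fun k => f x - F k x) (fun t => t ^+ 2) _ (nbhs (f x - f x))).
    by apply: cvgB; [exact: cvg_cst|exact: Ff].
  exact: exprn_continuous.
- move=> k x _; rewrite /= lee_fin ger0_norm ?sqr_ge0//.
  rewrite -[(f x - F k x) ^+ 2]real_normK ?num_real//; apply: lerXn2r.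
  + by rewrite nnegrE.
  + by rewrite nnegrE mulr_ge0.
  + apply: (le_trans (ler_normB _ _)); have := fh x; have := Fh k x; lra.
Qed.

End dominated_L2.

Section covariance.
Context {R : realType} {n : nat}.
Local Notation V := 'cV[R]_n.
Local Notation lambda := (@lebesgue_cV R n).
Implicit Types (T : (V -> R[i]) -> (V -> R[i])) (S : 'M[R]_(n + n))
  (z : 'cV[R]_(n + n)) (f g : V -> R[i]).

Lemma weyl_isometric z : isometric_op (@weyl R n z).
Proof.
have mphase : measurable_fun setT (fun x : V => 2 * pi * dotp (dsubmx z) x).
  by apply: measurable_funM; [exact: measurable_cst|exact: measurable_dotp].
split.
- by move=> f Lf; apply: L2_phase => //; exact: L2_shift.
- by move=> a f g x; rewrite /weyl; ring.
- move=> f Lf; rewrite -(L2normsq_shift (usubmx z) Lf).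
  by apply: L2normsq_eq_norm => x; rewrite normcM normc_expi mul1r.
Qed.

Lemma weyl_aeeq z f g : aeeq f g -> aeeq (weyl z f) (weyl z g).
Proof.
by move=> /(ae_cV_shift (usubmx z)); apply: filterS => x fg; rewrite /weyl fg.
Qed.

Section unitary.
Variable T : (V -> R[i]) -> (V -> R[i]).
Hypothesis uT : unitary_op T.

Lemma unitary_0 : aeeq (T (fun=> 0)) (fun=> 0).
Proof.
apply: L2normsq_eq0; first exact: (unitary_L2 uT L2_0).
rewrite (unitary_isometry uT L2_0) /L2normsq.
under eq_Rintegral do rewrite normc0 expr0n.
by rewrite /Rintegral integral0.
Qed.

Lemma unitary_scale (a : R[i]) f : L2 f ->
  aeeq (T (fun x => a * f x)) (fun x => a * T f x).
Proof.
move=> Lf; have := unitary_linear uT a Lf L2_0.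
rewrite (_ : (fun x => a * f x + 0) = (fun x => a * f x)); last first.
  by apply/funext => x; rewrite addr0.
by apply: filterS2 unitary_0 => x -> ->; rewrite addr0.
Qed.

Lemma unitary_sub f g : L2 f -> L2 g ->
  aeeq (T (fun x => f x - g x)) (fun x => T f x - T g x).
Proof.
move=> Lf Lg; have := unitary_linear uT (-1) Lg Lf.
rewrite (_ : (fun x => -1 * g x + f x) = (fun x => f x - g x)); last first.
  by apply/funext => x; rewrite mulN1r addrC.
by apply: filterS => x ->; rewrite mulN1r addrC.
Qed.

End unitary.

(** The phase w may depend on z, but not on f: so it disappears from commutators. *)
Definition covariant S T := forall z, exists2 w : R[i], normc w = 1 &
  forall f, L2 f -> aeeq (T (weyl z f)) (fun xi => w * weyl (S *m z) (T f) xi).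

Lemma Cintegral_shift (a : V) g : Cmeasurable g ->
  Cintegral (fun x => g (x - a)) = Cintegral g.
Proof.
move=> [g1 g2]; rewrite /Cintegral.
rewrite (@Rintegral_cV_shift _ _ a (fun x => complex.Re (g x)))//.
by rewrite (@Rintegral_cV_shift _ _ a (fun x => complex.Im (g x))).
Qed.

Lemma CintegralZ (w : R[i]) g :
  lambda.-integrable setT (EFin \o (fun x => complex.Re (g x))) ->
  lambda.-integrable setT (EFin \o (fun x => complex.Im (g x))) ->
  Cintegral (fun x => w * g x) = w * Cintegral g.
Proof.
move=> I1 I2.
have Z (t : R) (u : V -> R) : lambda.-integrable setT (EFin \o u) ->
    lambda.-integrable setT (EFin \o (fun x => t * u x)).
  by move=> Iu; exact: (@integrableZl _ _ _ lambda setT measurableT t (EFin \o u)).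
rewrite /Cintegral; apply: complex_ext; rewrite ?cReM ?cImM /=.
  rewrite -!RintegralZl// -RintegralB//; try exact: Z.
  by apply: eq_Rintegral => x _; rewrite cReM.
rewrite -!RintegralZl// -RintegralD//; try exact: Z.
by apply: eq_Rintegral => x _; rewrite cImM.
Qed.

Lemma dotp_mulmx_measurable (M : 'M[R]_n) :
  measurable_fun setT (fun x : V => dotp x (M *m x)).
Proof.
apply: measurable_sum => i; apply: measurable_funM; first exact: measurable_mx_coord.
under eq_fun do rewrite mxE.
apply: measurable_sum => j; apply: measurable_funM; first exact: measurable_cst.
exact: measurable_mx_coord.
Qed.

Lemma free_kernel_measurable S xi : Cmeasurable (free_kernel S xi).
Proof.
apply: Cmeasurable_expi; apply: measurable_funB; apply: measurable_funM;
  try exact: measurable_cst.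
  by apply: measurable_funD; [exact: measurable_cst|exact: dotp_mulmx_measurable].
under eq_fun do rewrite dotpC; exact: measurable_dotp.
Qed.

Lemma gauss_dominated_integrable (g : V -> R) (M : R) : measurable_fun setT g ->
  (forall x, `|g x| <= M * gauss x) -> lambda.-integrable setT (EFin \o g).
Proof.
move=> mg gM.
have := @integrableZl _ _ _ lambda setT measurableT M _ (gauss_integrable n).
apply: le_integrable => //; first exact/measurable_EFinP.
move=> x _; rewrite /= lee_fin; apply: le_trans (gM x) _; exact: ler_norm.
Qed.

(** The substitution x |-> x + a in the integral formula. *)
Lemma free_covariant_test S T z u (M : R) (t : R) :
  free_metaplectic S T ->
  (forall xi x,
    expi (2 * pi * dotp (dsubmx z) (x + usubmx z)) * free_kernel S xi (x + usubmx z) =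
    expi t * expi (2 * pi * dotp (dsubmx (S *m z)) xi) *
      free_kernel S (xi - usubmx (S *m z)) x) ->
  tame u -> (forall x, `|u x| <= M) ->
  aeeq (T (weyl z (real_test u)))
       (fun xi => expi t * weyl (S *m z) (T (real_test u)) xi).
Proof.
move=> [_ _ uT [c _ TE]] kE tu uM; set f := real_test u; set s := (_%:C : R[i]) in TE.
have Sf : schwartz f by rewrite -[f]weyl0; exact: weyl_real_test_schwartz.
have := TE _ (weyl_real_test_schwartz z tu).
have := ae_cV_shift (usubmx (S *m z)) (TE _ Sf).
apply: filterS2 => xi Txi ->; rewrite /weyl Txi.
set a := usubmx z; set b := dsubmx z; set xi' := xi - _.
set w := expi (2 * pi * dotp _ xi).
have mf : Cmeasurable f.
  apply: Cmeasurable_real; apply: measurable_funM; first exact: tame_measurable.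
  exact: measurable_gauss.
have mg : Cmeasurable (fun x => f x * free_kernel S xi' x).
  by apply: CmeasurableM => //; exact: free_kernel_measurable.
have gle x : normc (f x * free_kernel S xi' x) <= M * gauss x.
  rewrite normcM normc_expi mulr1 normc_real normrM (gtr0_norm (gauss_gt0 x)).
  by rewrite ler_wpM2r// ltW// gauss_gt0.
have E : Cintegral (fun x => expi (2 * pi * dotp b x) * f (x - a) * free_kernel S xi x)
    = expi t * w * Cintegral (fun x => f x * free_kernel S xi' x).
  rewrite -CintegralZ.
  - rewrite -[RHS](Cintegral_shift a); last by apply: CmeasurableM => //; exact: Cmeasurable_cst.
    congr Cintegral; apply/funext => x.
    by rewrite mulrCA -kE subrK; ring.
  - apply: (gauss_dominated_integrable (M := M)) => [|x]; first by case: mg.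
    exact: le_trans (Re_le_normc _) (gle x).
  - apply: (gauss_dominated_integrable (M := M)) => [|x]; first by case: mg.
    exact: le_trans (Im_le_normc _) (gle x).
rewrite E; ring.
Qed.

(** The defect of covariance is linear and bounded on L2, and vanishes on the test
functions. *)
Lemma free_covariant S T : free_metaplectic S T -> covariant S T.
Proof.
move=> fT; have [hS fS uT _] := fT => z; have [t kE] := free_kernel_shift z hS fS.
exists (expi t); first exact: normc_expi.
have isoz := weyl_isometric z; have isoSz := weyl_isometric (S *m z).
pose G f := fun xi => T (weyl z f) xi - expi t * weyl (S *m z) (T f) xi.
have LTz f : L2 f -> L2 (T (weyl z f)).
  by move=> Lf; apply: (unitary_L2 uT); exact: (isom_L2 isoz).
have LzT f : L2 f -> L2 (fun xi => expi t * weyl (S *m z) (T f) xi).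
  by move=> Lf; apply: L2Z; apply: (isom_L2 isoSz); exact: (unitary_L2 uT).
have GE f : aeeq (T (weyl z f)) (fun xi => expi t * weyl (S *m z) (T f) xi) <->
    aeeq (G f) (fun=> 0).
  split; apply: filterS => xi; rewrite /G; first by move=> ->; rewrite subrr.
  by move/eqP; rewrite subr_eq0 => /eqP.
have G_lin a f g : L2 f -> L2 g ->
    aeeq (G (fun x => a * f x + g x)) (fun xi => a * G f xi + G g xi).
  move=> Lf Lg.
  have e1 : weyl z (fun x => a * f x + g x) = (fun x => a * weyl z f x + weyl z g x).
    by apply/funext => x; rewrite (isom_linear isoz).
  have := unitary_linear uT a (isom_L2 isoz Lf) (isom_L2 isoz Lg).
  have := weyl_aeeq (S *m z) (unitary_linear uT a Lf Lg).
  rewrite /G e1; apply: filterS2 => xi -> ->.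
  by rewrite (isom_linear isoSz); ring.
have G_norm f : L2 f -> L2normsq (G f) <= 4 * L2normsq f.
  move=> Lf; have := L2normsqD (LTz f Lf) (L2Z (-1) (LzT f Lf)).
  rewrite (_ : (fun x => _ + -1 * _) = G f); last by apply/funext => x; rewrite mulN1r.
  rewrite L2normsqZ; last exact: LzT.
  rewrite L2normsqZ; last by apply: (isom_L2 isoSz); exact: (unitary_L2 uT).
  rewrite (isom_norm isoSz); last exact: (unitary_L2 uT).
  rewrite !(unitary_isometry uT)//; last exact: (isom_L2 isoz).
  rewrite (isom_norm isoz)// normcN normc1 normc_expi expr1n !mul1r => h.
  by rewrite (_ : 4 * _ = 2 * L2normsq f + 2 * L2normsq f)//; ring.
have LG f : L2 f -> L2 (G f) by move=> Lf; exact: L2B (LTz f Lf) (LzT f Lf).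
apply: L2_density.
- by move=> u M tu uM; exact: free_covariant_test fT kE tu uM.
- move=> a f g Lf Lg /GE Gf /GE Gg; apply/GE.
  have := G_lin a f g Lf Lg.
  by apply: filterS3 Gf Gg => xi -> -> ->; rewrite mulr0 addr0.
- move=> F f h LF Lh Fh Ff GF.
  have [Lf cvg0] := L2_dominated_cvg LF Lh Fh Ff; apply/GE.
  apply: L2normsq_eq0; first exact: LG.
  apply/eqP; rewrite eq_le L2normsq_ge0 andbT.
  have bound k : L2normsq (G (fun x => (f x)%:C)) <=
      4 * L2normsq (fun x => (f x)%:C - (F k x)%:C).
    have Ld := L2B Lf (LF k); apply: le_trans _ (G_norm _ Ld).
    rewrite (L2normsq_aeeq (LG _ Lf) (LG _ Ld))//.
    have := G_lin 1 _ _ Ld (LF k).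
    rewrite (_ : (fun x => 1 * _ + _) = (fun x => (f x)%:C)); last first.
      by apply/funext => x; rewrite mul1r subrK.
    have /GE GFk := GF k.
    by apply: filterS2 GFk => xi -> ->; rewrite mul1r addr0.
  rewrite -(mulr0 4).
  by apply: (cvgr_to_ge (cvgM (cvg_cst _) cvg0)); apply: nearW => k; exact: bound.
Qed.

Lemma metaplectic_unitary S T : metaplectic S T -> unitary_op T.
Proof. by case => [[]|[S1 [S2 [T1 [T2 []]]]]]. Qed.

(** Intertwining relations compose, and so do their phases. *)
Lemma metaplectic_covariant S T : metaplectic S T -> covariant S T.
Proof.
case => [|[S1 [S2 [T1 [T2 [fT1 fT2 -> uT TE]]]]]]; first exact: free_covariant.
move=> z.
have [_ _ uT1 _] := fT1; have [_ _ uT2 _] := fT2.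
have [w2 w21 c2] := free_covariant fT2 z.
have [w1 w11 c1] := free_covariant fT1 (S2 *m z).
exists (w2 * w1); first by rewrite normcM w21 w11 mulr1.
move=> f Lf; have isoz := weyl_isometric z.
have LT2 : L2 (T2 f) by exact: unitary_L2.
have Lw : L2 (weyl (S2 *m z) (T2 f)) by exact: (isom_L2 (weyl_isometric _)).
have e1 := TE _ (isom_L2 isoz Lf).
have e2 : aeeq (T1 (T2 (weyl z f))) (T1 (fun x => w2 * weyl (S2 *m z) (T2 f) x)).
  apply: (unitary_aeeq uT1); last exact: c2.
    by apply: (unitary_L2 uT2); exact: (isom_L2 isoz).
  exact: L2Z.
have e3 := unitary_scale uT1 w2 Lw.
have e4 := c1 _ LT2.
have e5 := weyl_aeeq (S1 *m S2 *m z) (TE _ Lf).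
apply: (aeeq_trans e1); apply: (aeeq_trans e2); apply: (aeeq_trans e3).
apply: filterS2 e4 e5 => x -> ->.
by rewrite mulmxA mulrA.
Qed.

End covariance.

(** * Uncertainty inequalities *)

Section trigonometric_bounds.
Context {R : realType}.

Lemma abs_sin_le (x : R) : `|sin x| <= `|x|.
Proof.
wlog x0 : x / 0 <= x.
  move=> H; have [/H//|x0] := leP 0 x.
  by rewrite -(normrN x) -(normrN (sin x)) -sinN; apply: H; rewrite oppr_ge0 ltW.
have [|c _] := @MVT_segment R sin cos 0 x x0 (fun y _ => is_derive_sin y).
  by apply: continuous_subspaceT; exact: continuous_sin.
rewrite sin0 !subr0 => ->; rewrite normrM ler_piMl//.
by rewrite ler_norml cos_geN1 cos_le1.
Qed.

(** |exp(i t) - 1| = 2 |sin(t / 2)|. *)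
Lemma normc_expiB1 (t : R) : normc (expi t - 1) <= `|t|.
Proof.
rewrite -(ler_pXn2r (ltn0Sn 1)) ?nnegrE ?normc_ge0//.
have -> : normc (expi t - 1) ^+ 2 = 4 * sin (t / 2) ^+ 2.
  have ht : t = (t / 2) *+ 2 by rewrite -mulr_natr; field.
  rewrite normc_sqr cReD cImD /= {1 2}ht cos_mulr2n sin_mulr2n.
  have := cos2Dsin2 (t / 2); move: (cos _) (sin _) => c s cs.
  have -> : c ^+ 2 = 1 - s ^+ 2 by rewrite -cs; ring.
  rewrite !mulr2n (_ : (c * s + c * s + - 0) ^+ 2 = 4 * c ^+ 2 * s ^+ 2); last by ring.
  rewrite (_ : c ^+ 2 = 1 - s ^+ 2); last by rewrite -cs; ring.
  by ring.
have : `|sin (t / 2)| ^+ 2 <= `|t / 2| ^+ 2.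
  by apply: lerXn2r; rewrite ?nnegrE//; exact: abs_sin_le.
rewrite !real_normK ?num_real// => h.
rewrite (_ : t ^+ 2 = 4 * (t / 2) ^+ 2); last by field.
lra.
Qed.

Lemma cvg_sin_over (c : R) : d^-1 * sin (c * d) @[d --> 0^'+] --> c.
Proof.
apply: cvg_dnbhs_at_right.
have dlin : is_derive (0 : R) 1 (fun d : R => c * d) c.
  have -> : (fun d : R => c * d) = c \*: (id : R -> R) by [].
  by apply: is_derive_eq; rewrite /GRing.scale/= mulr1.
have dsin : is_derive (0 : R) 1 (sin \o (fun d : R => c * d)) (cos (c * 0) * c).
  exact: (is_derive1_comp (is_derive_sin (c * 0)) dlin).
have [+ derE] := dsin; rewrite /derivable -/(derive _ _ _) derE mulr0 cos0 mul1r.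
rewrite (_ : (fun h => _) = (fun d => d^-1 * sin (c * d)))//.
apply/funext => d; rewrite /= addr0 /GRing.scale/= mulr1 mulr0 sin0 subr0//.
Qed.

(** Divide by d and let d decrease to 0: only the first-order terms remain. *)
Lemma commutator_limit (N K c p : R) : 0 < c ->
  (forall d, 0 < d -> c * d <= pi -> sin (c * d) * (N - d * K) <= d * p) ->
  c * N <= p.
Proof.
move=> c0 H.
have lim : (d^-1 * sin (c * d)) * (N - d * K) @[d --> 0^'+] --> c * (N - 0 * K).
  apply: cvgM; first exact: cvg_sin_over.
  apply: cvgB; first exact: cvg_cst.
  apply: cvgM; last exact: cvg_cst.
  by apply: (@cvg_at_right_filter _ _ id); exact: cvg_id.
rewrite mul0r subr0 in lim; apply: (cvgr_to_le lim); near=> d.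
have d0 : 0 < d by near: d; exact: nbhs_right_gt.
have dc : d <= pi / c by near: d; apply: nbhs_right_le; rewrite divr_gt0// pi_gt0.
rewrite -mulrA -ler_pdivlMl ?invr_gt0// invrK; apply: H => //.
by rewrite mulrC -ler_pdivlMr.
Unshelve. all: by end_near. Qed.

Lemma cauchy_schwarz_sum (I : finType) (a b : I -> R) :
  (forall i, 0 <= a i) -> (forall i, 0 <= b i) ->
  \sum_i a i * b i <= Num.sqrt (\sum_i a i ^+ 2) * Num.sqrt (\sum_i b i ^+ 2).
Proof.
move=> a0 b0.
have sA : 0 <= \sum_i a i ^+ 2 by apply: sumr_ge0 => i _; exact: sqr_ge0.
have sB : 0 <= \sum_i b i ^+ 2 by apply: sumr_ge0 => i _; exact: sqr_ge0.
set A := Num.sqrt (\sum_i a i ^+ 2); set B := Num.sqrt (\sum_i b i ^+ 2).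
have AE : A ^+ 2 = \sum_i a i ^+ 2 by exact: sqr_sqrtr.
have BE : B ^+ 2 = \sum_i b i ^+ 2 by exact: sqr_sqrtr.
have A0 : 0 <= A by exact: sqrtr_ge0.
have B0 : 0 <= B by exact: sqrtr_ge0.
have le_root (u : I -> R) i : (forall i, 0 <= u i) -> u i <= Num.sqrt (\sum_i u i ^+ 2).
  move=> u0; rewrite -[leLHS]ger0_norm// -sqrtr_sqr; apply: ler_wsqrtr.
  by rewrite (bigD1 i)//= lerDl; apply: sumr_ge0 => k _; exact: sqr_ge0.
have [A00|Anz] := eqVneq A 0.
  rewrite A00 mul0r big1// => i _; have := le_root a i a0; rewrite -/A A00 => h.
  by rewrite (_ : a i = 0) ?mul0r//; apply/eqP; rewrite eq_le h a0.
have [B00|Bnz] := eqVneq B 0.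
  rewrite B00 mulr0 big1// => i _; have := le_root b i b0; rewrite -/B B00 => h.
  by rewrite (_ : b i = 0) ?mulr0//; apply/eqP; rewrite eq_le h b0.
have AB : 0 < A * B by rewrite mulr_gt0// lt_neqAle eq_sym ?Anz ?Bnz.
(* Sum of the inequalities 2 A B a_i b_i <= B^2 a_i^2 + A^2 b_i^2. *)
rewrite -(ler_pM2l AB) -(ler_pM2l (ltr0n R 2)) !mulr_sumr.
apply: (@le_trans _ _ (\sum_i (B ^+ 2 * a i ^+ 2 + A ^+ 2 * b i ^+ 2))).
  apply: ler_sum => i _; have := sqr_ge0 (B * a i - A * b i); nra.
rewrite big_split/= -!mulr_sumr -AE -BE.
by rewrite le_eqVlt; apply/orP; left; apply/eqP; ring.
Qed.

End trigonometric_bounds.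

Section uncertainty.
Context {R : realType} {n : nat}.
Local Notation V := 'cV[R]_n.
Local Notation lambda := (@lebesgue_cV R n).
Implicit Types (T : (V -> R[i]) -> (V -> R[i])) (S : 'M[R]_(n + n))
  (y z : 'cV[R]_(n + n)) (f g : V -> R[i]).

(** The symplectic form on phase space, which measures the failure of Weyl
operators to commute. *)
Definition sform y z : R :=
  dotp (dsubmx y) (usubmx z) - dotp (dsubmx z) (usubmx y).

Lemma sformC y z : sform z y = - sform y z.
Proof. by rewrite /sform opprB. Qed.

Lemma sformZ (t : R) y z : sform (t *: y) (t *: z) = t ^+ 2 * sform y z.
Proof.
have usZ (w : 'cV[R]_(n + n)) : usubmx (t *: w) = t *: usubmx w.
  by apply/matrixP => i k; rewrite !mxE.
have dsZ (w : 'cV[R]_(n + n)) : dsubmx (t *: w) = t *: dsubmx w.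
  by apply/matrixP => i k; rewrite !mxE.
by rewrite /sform !usZ !dsZ !dotpZl !(dotpC _ (t *: _)) !dotpZl (dotpC (usubmx z))
  (dotpC (usubmx y)); ring.
Qed.

Lemma weylC y z f x :
  weyl y (weyl z f) x = expi (2 * pi * sform y z) * weyl z (weyl y f) x.
Proof.
rewrite /weyl !mulrA -!expiD.
rewrite (_ : x - usubmx y - usubmx z = x - usubmx z - usubmx y); last by rewrite addrAC.
congr (expi _ * _); rewrite /sform !(dotpDr, dotpNr); ring.
Qed.

(** The direction in phase space whose Weyl operators are the modulations in the
coordinate j. *)
Definition momentum (j : 'I_n) : 'cV[R]_(n + n) := col_mx 0 (delta_mx j 0).

Definition symplectic_inv S : 'M[R]_(n + n) := - (Jmx *m S^T *m Jmx).

Lemma Jmx_sqr : Jmx *m Jmx = - 1%:M :> 'M[R]_(n + n).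
Proof.
rewrite /Jmx mulmx_block !(mul0mx, mulmx0, mul1mx, mulmx1, addr0, add0r).
by rewrite scalar_mx_block opp_block_mx !oppr0.
Qed.

Lemma symplectic_invP S : symplectic S -> S *m symplectic_inv S = 1%:M.
Proof.
move=> hS; apply: mulmx1C; rewrite /symplectic_inv mulNmx.
by rewrite -!mulmxA (mulmxA S^T) hS Jmx_sqr opprK.
Qed.

Lemma sformE y z : sform y z = - (y^T *m Jmx *m z) 0 0.
Proof.
have dotpE (u v : V) : dotp u v = (u^T *m v) 0 0.
  by rewrite mxE; apply: eq_bigr => i _; rewrite mxE.
rewrite -[in RHS](vsubmxK y) -[in RHS](vsubmxK z) tr_col_mx /Jmx.
rewrite mul_row_block !mulmx0 !mulmx1 mulmxN mulmx1 add0r addr0 mul_row_col.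
rewrite mxE -!dotpE mulNmx [X in _ = - (X + _)]mxE -dotpE /sform.
rewrite (dotpC (usubmx y)); ring.
Qed.

(** By S^-1 = - J S^T J, since J carries (0, e_j) to (e_j, 0). *)
Lemma sform_momentum S1 S2 (j : 'I_n) :
  sform (symplectic_inv S1 *m momentum j) (symplectic_inv S2 *m momentum j) =
  - (S1 *m Jmx *m S2^T) (lshift n j) (lshift n j).
Proof.
rewrite sformE; congr (- _).
have JT : (Jmx : 'M[R]_(n + n))^T = - Jmx.
  by rewrite /Jmx tr_block_mx !trmx0 linearN /= trmx1 opp_block_mx !oppr0 opprK.
pose q : 'cV[R]_(n + n) := col_mx (delta_mx j 0) 0.
have Jp : Jmx *m momentum j = q.
  by rewrite /Jmx /momentum mul_block_col !mulmx0 mul0mx mul1mx addr0 add0r.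
have qE : q = delta_mx (lshift n j) 0.
  apply/matrixP => i k; rewrite (ord1 k) /q.
  by case: (split_ordP i) => l ->; rewrite ?col_mxEu ?col_mxEd !mxE ?eq_shift.
have E : (symplectic_inv S1 *m momentum j)^T *m Jmx *m (symplectic_inv S2 *m momentum j)
    = q^T *m (S1 *m Jmx *m S2^T) *m q.
  rewrite /symplectic_inv !mulNmx -!mulmxA Jp [X in X *m _]linearN /= !mulNmx !mulmxN opprK.
  rewrite !trmx_mul !trmxK JT (mulmxA Jmx Jmx) Jmx_sqr !(mulNmx, mul1mx, mulmxN) opprK.
  by rewrite !mulmxA.
by rewrite E qE trmx_delta -rowE -colE !mxE.
Qed.

(** Covariance applied at z = S^-1 (0, d e_j).  The factor w absorbs the phase of
covariance as well as the recentring by m. *)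
Lemma covariant_modulation S T j (m d : R) : symplectic S -> covariant S T ->
  unitary_op T -> exists2 w : R[i], normc w = 1 &
  forall f, L2 f ->
    aeeq (T (fun x => w * weyl (d *: (symplectic_inv S *m momentum j)) f x))
         (fun xi => expi (2 * pi * d * (xi j 0 - m)) * T f xi).
Proof.
move=> hS cT uT; set z := d *: _; have [w w1 cov] := cT z.
have w0 : w != 0.
  by apply/eqP => w0; move: w1; rewrite w0 normc0 => /eqP; rewrite eq_sym oner_eq0.
exists (w^-1 * expi (- (2 * pi * d * m))).
  by rewrite normcM normc_expi mulr1 normcV w1 invr1.
move=> f Lf; have Lz := isom_L2 (weyl_isometric z) Lf.
have Sz : S *m z = d *: momentum j.
  by rewrite /z -scalemxAr mulmxA symplectic_invP// mul1mx.
have := cov f Lf; rewrite Sz => covf.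
apply: aeeq_trans (unitary_scale uT _ Lz) _.
apply: filterS covf => xi ->.
have -> : weyl (d *: momentum j) (T f) xi = expi (2 * pi * (d * xi j 0)) * T f xi.
  rewrite /weyl.
  have -> : usubmx (d *: momentum j) = 0.
    transitivity (d *: usubmx (momentum j)); first by apply/matrixP => i k; rewrite !mxE.
    by rewrite col_mxKu scaler0.
  have -> : dsubmx (d *: momentum j) = d *: delta_mx j 0.
    transitivity (d *: dsubmx (momentum j)); first by apply/matrixP => i k; rewrite !mxE.
    by rewrite col_mxKd.
  rewrite subr0 dotpZl /dotp (bigD1 j)//= big1 => [|i ij]; last first.
    by rewrite mxE (negbTE ij) mul0r.
  by rewrite mxE !eqxx mul1r addr0.
rewrite -!mulrA [_ * (w * _)]mulrCA !mulrA mulVf// mul1r -expiD.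
by congr (expi _ * _); ring.
Qed.

(** The commutator estimate applied to the two modulations in the coordinate j, in
the limit d -> 0. *)
Lemma coordinate_uncertainty_pos S1 S2 T1 T2 f (j : 'I_n) (m1 m2 : R) :
  symplectic S1 -> symplectic S2 -> covariant S1 T1 -> covariant S2 T2 ->
  unitary_op T1 -> unitary_op T2 -> L2 f ->
  let g1 (x : V) := (x j 0 - m1)%:C * T1 f x in
  let g2 (x : V) := (x j 0 - m2)%:C * T2 f x in
  let s := sform (symplectic_inv S1 *m momentum j) (symplectic_inv S2 *m momentum j) in
  L2 g1 -> L2 g2 -> 0 < s ->
  L2normsq f / (4 * pi) * s <= Num.sqrt (L2normsq g1) * Num.sqrt (L2normsq g2).
Proof.
move=> hS1 hS2 c1 c2 u1 u2 Lf g1 g2 s Lg1 Lg2 s0.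
set y1 := symplectic_inv S1 *m _ in s s0 *; set y2 := symplectic_inv S2 *m _ in s s0 *.
set a := Num.sqrt (L2normsq g1); set b := Num.sqrt (L2normsq g2).
have a0 : 0 <= a by exact: sqrtr_ge0.
have b0 : 0 <= b by exact: sqrtr_ge0.
have pi0 : 0 < pi :> R by exact: pi_gt0.
have isow (w : R[i]) z : normc w = 1 -> isometric_op (fun g x => w * weyl z g x).
  move=> w1; have iso := weyl_isometric z; split.
  - by move=> g Lg; apply: L2Z; exact: (isom_L2 iso).
  - by move=> c g h x; rewrite (isom_linear iso); ring.
  - move=> g Lg; rewrite L2normsqZ; last exact: (isom_L2 iso).
    by rewrite w1 expr1n mul1r (isom_norm iso).
have small S T m (d : R) w (z := d *: (symplectic_inv S *m momentum j))
    (g := fun x : V => (x j 0 - m)%:C * T f x) :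
    unitary_op T -> normc w = 1 -> 0 < d -> L2 g ->
    aeeq (T (fun x => w * weyl z f x)) (fun xi => expi (2 * pi * d * (xi j 0 - m)) * T f xi) ->
    L2normsq (fun x => w * weyl z f x - f x) <= (2 * pi * d * Num.sqrt (L2normsq g)) ^+ 2.
  move=> uT w1 d0 Lg E.
  have Lw : L2 (fun x => w * weyl z f x) by exact: (isom_L2 (isow w z w1) Lf).
  have Ld := L2B Lw Lf.
  rewrite -(unitary_isometry uT Ld).
  have LTf := unitary_L2 uT Lf.
  have LTd := unitary_L2 uT Ld.
  have mj : measurable_fun setT (fun xi : V => 2 * pi * d * (xi j 0 - m)).
    apply: measurable_funM; first exact: measurable_cst.
    by apply: measurable_funB; [exact: measurable_mx_coord|exact: measurable_cst].
  have Lmod := L2B (L2_phase mj LTf) LTf.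
  have Etot : aeeq (T (fun x => w * weyl z f x - f x))
      (fun xi => expi (2 * pi * d * (xi j 0 - m)) * T f xi - T f xi).
    by apply: filterS2 (unitary_sub uT Lw Lf) E => xi -> ->.
  rewrite (L2normsq_aeeq LTd Lmod Etot).
  rewrite exprMn sqr_sqrtr ?L2normsq_ge0//.
  have -> : (2 * pi * d) ^+ 2 * L2normsq g =
      L2normsq (fun x => (2 * pi * d)%:C * g x).
    by rewrite L2normsqZ// normc_real -normrX ger0_norm ?sqr_ge0.
  apply: L2normsq_le => //; first exact: L2Z.
  move=> xi; rewrite -[X in _ - X]mul1r -mulrBl /g mulrA !normcM.
  rewrite ler_wpM2r ?normc_ge0// -normcM -rmorphM normc_real.
  exact: normc_expiB1.
have main : (pi * s) * L2normsq f <= (2 * pi) ^+ 2 * (a * b).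
  apply: (@commutator_limit _ _ ((2 * pi) ^+ 2 * (b ^+ 2 + a ^+ 2))).
    exact: mulr_gt0.
  move=> d d0 dpi.
  (* Parameter sqrt d for both modulations makes their commutation phase linear
     in d. *)
  set e := Num.sqrt d; have e0 : 0 < e by rewrite sqrtr_gt0.
  have e2 : e ^+ 2 = d by rewrite sqr_sqrtr// ltW.
  have [w1 nw1 E1] := covariant_modulation j m1 e hS1 c1 u1.
  have [w2 nw2 E2] := covariant_modulation j m2 e hS2 c2 u2.
  have := @commutator_le _ _ _ _ (isow w2 (e *: y2) nw2) (isow w1 (e *: y1) nw1) f
    (pi * s * d) (2 * pi * e * b) (2 * pi * e * a) Lf.
  have h2 : 0 <= 2 * pi * e by rewrite !mulr_ge0// ltW.
  move=> /(_ (mulr_ge0 h2 b0) (mulr_ge0 h2 a0)).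
  have comm x : w1 * weyl (e *: y1) (fun x => w2 * weyl (e *: y2) f x) x =
      expi (pi * s * d + pi * s * d) *
      (w2 * weyl (e *: y2) (fun x => w1 * weyl (e *: y1) f x) x).
    have lin z w g : weyl z (fun x => w * g x) x = w * weyl z g x.
      by rewrite /weyl; ring.
    rewrite !lin weylC sformZ e2.
    rewrite (_ : 2 * pi * (d * sform y1 y2) = pi * s * d + pi * s * d); last first.
      by rewrite /s; ring.
    ring.
  move=> /(_ comm).
  have sin0 : 0 <= sin (pi * s * d).
    by apply: sin_ge0_pi; rewrite dpi andbT !mulr_ge0// ltW.
  move=> /(_ sin0 (small _ _ _ _ _ u2 nw2 e0 Lg2 (E2 f Lf))).
  move=> /(_ (small _ _ _ _ _ u1 nw1 e0 Lg1 (E1 f Lf))).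
  have -> : (2 * pi * e * b) ^+ 2 + (2 * pi * e * a) ^+ 2 =
      d * ((2 * pi) ^+ 2 * (b ^+ 2 + a ^+ 2)) by rewrite -e2; ring.
  by have -> : 2 * pi * e * b * (2 * pi * e * a) = d * ((2 * pi) ^+ 2 * (a * b))
    by rewrite -e2; ring.
rewrite mulrAC ler_pdivrMr ?mulr_gt0//.
have := main; rewrite (_ : (2 * pi) ^+ 2 * (a * b) = pi * (a * b * (4 * pi))); last by ring.
by rewrite -mulrA ler_pM2l// mulrC.
Qed.

(** The symplectic form is antisymmetric, so that exchanging the two operators
reduces to the case where it is positive. *)
Lemma coordinate_uncertainty S1 S2 T1 T2 f (j : 'I_n) (m1 m2 : R) :
  symplectic S1 -> symplectic S2 -> covariant S1 T1 -> covariant S2 T2 ->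
  unitary_op T1 -> unitary_op T2 -> L2 f ->
  let g1 (x : V) := (x j 0 - m1)%:C * T1 f x in
  let g2 (x : V) := (x j 0 - m2)%:C * T2 f x in
  L2 g1 -> L2 g2 ->
  L2normsq f / (4 * pi) * `|(S1 *m Jmx *m S2^T) (lshift n j) (lshift n j)| <=
  Num.sqrt (L2normsq g1) * Num.sqrt (L2normsq g2).
Proof.
move=> hS1 hS2 c1 c2 u1 u2 Lf g1 g2 Lg1 Lg2.
rewrite -normrN -sform_momentum.
have [s0|s0|->] := ltgtP (sform (symplectic_inv S1 *m momentum j)
  (symplectic_inv S2 *m momentum j)) 0.
- rewrite ltr0_norm// -sformC mulrC [leRHS]mulrC mulrC.
  by apply: coordinate_uncertainty_pos => //; rewrite sformC oppr_gt0.
- by rewrite gtr0_norm//; exact: coordinate_uncertainty_pos.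
- by rewrite normr0 mulr0 mulr_ge0 ?sqrtr_ge0.
Qed.

Lemma L2_coordinate f (j : 'I_n) (m : R) : L2 f ->
  L2 (fun x => (enorm x)%:C * f x) -> L2 (fun x : V => (x j 0 - m)%:C * f x).
Proof.
move=> Lf Lef.
have L1 : L2 (fun x : V => (x j 0)%:C * f x).
  apply: L2_dominated (Lef) _.
    apply: CmeasurableM; last exact: L2_Cmeasurable.
    by apply: Cmeasurable_real; exact: measurable_mx_coord.
  move=> x; rewrite !normcM ler_wpM2r ?normc_ge0// !normc_real.
  rewrite [leRHS]ger0_norm ?sqrtr_ge0// -sqrtr_sqr.
  by apply: ler_wsqrtr; exact: dotp_coord.
have := L2B L1 (L2Z m%:C Lf); congr L2.
by apply/funext => x; rewrite -mulrBl -rmorphB.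
Qed.

(** Pythagoras; the weighted hypothesis makes each coordinate variance finite, as
splitting the integral requires. *)
Lemma spread_sqr T f : L2 (T f) -> L2 (fun x => (enorm x)%:C * T f x) ->
  spread T f = Num.sqrt (\sum_(j < n)
    Num.sqrt (L2normsq (fun x : V => (x j 0 - mean T f j 0)%:C * T f x)) ^+ 2).
Proof.
move=> Lf Lef; congr Num.sqrt.
under eq_bigr do rewrite sqr_sqrtr ?L2normsq_ge0//.
pose F (j : 'I_n) (x : V) := normc ((x j 0 - mean T f j 0)%:C * T f x) ^+ 2.
have IF j : lambda.-integrable setT (EFin \o F j).
  by apply: L2_integrable; exact: L2_coordinate.
have sumE (s : seq 'I_n) :
    lambda.-integrable setT (EFin \o (fun x => \sum_(j <- s) F j x)) /\
    \int[lambda]_x (\sum_(j <- s) F j x) = \sum_(j <- s) \int[lambda]_x F j x.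
  elim: s => [|j s [IS IH]].
    split; last by rewrite big_nil; under eq_Rintegral do rewrite big_nil;
      rewrite /Rintegral integral0.
    rewrite (_ : _ \o _ = cst 0%E); first exact: integrable0.
    by apply/funext => x; rewrite /= big_nil.
  have sumS : (fun x => \sum_(i <- j :: s) F i x) = (fun x => F j x + \sum_(i <- s) F i x).
    by apply/funext => x; rewrite big_cons.
  rewrite sumS; split; first exact: (integrableD _ (IF j) IS).
  by rewrite RintegralD// IH big_cons.
have [_ <-] := sumE (index_enum 'I_n).
apply: eq_Rintegral => x _; rewrite /F sqr_sqrtr ?dotp_ge0// /dotp mulr_suml.
apply: eq_bigr => j _; rewrite !mxE normcM exprMn normc_real; congr (_ * _).
by rewrite real_normK ?num_real// expr2.
Qed.

End uncertainty.

Theorem corollary6 (R : realType) (n : nat) (S1 S2 : 'M[R]_(n + n))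
    (T1 T2 : ('cV[R]_n -> R[i]) -> ('cV[R]_n -> R[i]))
    (f : 'cV[R]_n -> R[i])
    (hS1 : symplectic S1) (hS2 : symplectic S2)
    (hT1 : metaplectic S1 T1) (hT2 : metaplectic S2 T2)
    (hf : L2 f) (hf0 : ~ aeeq f (fun=> 0))
    (hx : L2 (fun x => (enorm x)%:C * T1 f x))
    (hxi : L2 (fun xi => (enorm xi)%:C * T2 f xi)) :
  spread T1 f * spread T2 f >=
    L2normsq f / (4 * pi) *
    \sum_(j < n) `|(S1 *m Jmx *m S2^T) (lshift n j) (lshift n j)|.
Proof.
have u1 := metaplectic_unitary hT1; have u2 := metaplectic_unitary hT2.
have L1 := unitary_L2 u1 hf; have L2f := unitary_L2 u2 hf.
rewrite !spread_sqr//.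
apply: le_trans (cauchy_schwarz_sum _ _); last 2 first.
- by move=> j; exact: sqrtr_ge0.
- by move=> j; exact: sqrtr_ge0.
rewrite mulr_sumr; apply: ler_sum => j _.
by apply: coordinate_uncertainty => //;
  [exact: metaplectic_covariant|exact: metaplectic_covariant
  |exact: L2_coordinate|exact: L2_coordinate].
Qed.
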